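(* Let $\mathcal{A}$ be a unital $C^*$-algebra, $\mathcal{H}$ a Hilbert space, $k\in\mathbb{N}$, and let $\varphi:\mathcal{A}^k\to\mathcal{B}(\mathcal{H})$ be an invariant completely positive $k$-linear map. Then $\|\varphi\|_{cb}=\|\varphi(1,1,\ldots,1)\|$.
   Context: Let $\mathcal{B}=\mathcal{B}(\mathcal{H})$, $m=\lfloor (k+1)/2\rfloor$ (so $k=2m-1$ or $k=2m$), and $\mathcal{A}^k=\mathcal{A}\times\cdots\times\mathcal{A}$ ($k$ times). A $k$-linear map $\varphi:\mathcal{A}^k\to\mathcal{B}$ between unital $C^*$-algebras is positive if $\varphi(a_1,\ldots,a_k)\ge 0$ whenever $(a_1,a_2,\ldots,a_k)=(a_k^*,a_{k-1}^*,\ldots,a_1^* )$, with the additional assumption $a_m\ge 0$ when $k$ is odd. For $t\in\mathbb{N}$, the $t$-amplification of $\varphi$ is the $k$-linear map $\varphi_t:M_t(\mathcal{A})^k\to M_t(\mathcal{B})$ whose value at $(A_1,\ldots,A_k)$, $A_l=[a_{l,ij}]$, has $(i,j)$ entry $\sum_{r_1,\ldots,r_{k-1}=1}^t\varphi(a_{1,ir_1},a_{2,r_1r_2},\ldots,a_{k,r_{k-1}j})$. The map $\varphi$ is completely positive if $\varphi_t$ is positive for every $t\in\mathbb{N}$. Its completely bounded norm is $\|\varphi\|_{cb}:=\sup_{t\in\mathbb{N}}\|\varphi_t\|$, where $\|\varphi_t\|=\sup\{\|\varphi_t(A_1,\ldots,A_k)\|:\|A_l\|\le1,\ 1\le l\le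 k\}$. A $k$-linear map $\varphi:\mathcal{A}^k\to\mathcal{B}$ is invariant if: when $k=2m-1$, $\varphi(a_1c_1,\ldots,a_{m-1}c_{m-1},a_m,a_{m+1},\ldots,a_{2m-1})=\varphi(a_1,\ldots,a_{m-1},a_m,c_{m-1}a_{m+1},\ldots,c_1a_{2m-1})$ for all $a_1,\ldots,a_{2m-1},c_1,\ldots,c_{m-1}\in\mathcal{A}$; when $k=2m$, $\varphi(a_1c_1,\ldots,a_mc_m,a_{m+1},\ldots,a_{2m})=\varphi(a_1,\ldots,a_m,c_ma_{m+1},\ldots,c_1a_{2m})$ for all $a_1,\ldots,a_{2m},c_1,\ldots,c_m\in\mathcal{A}$. *)

(* Defs.v *)
From HB Require Import structures.
From mathcomp Require Import all_boot all_order all_algebra.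
From mathcomp Require Import sesquilinear complex.
From mathcomp Require Import all_classical all_reals all_analysis.

Set Implicit Arguments.
Unset Strict Implicit.
Unset Printing Implicit Defensive.

Import Order.TTheory GRing.Theory Num.Theory.
Import numFieldNormedType.Exports.

Local Open Scope classical_set_scope.
Local Open Scope complex_scope.
Local Open Scope ring_scope.

(* Hierarchy Builder cannot join the normed and the ring hierarchies outside of
   numDomainType, so the product is a field of the mixin and the (possibly
   zero) ring structure is derived from it below. *)
HB.mixin Record isCStarAlgebra (R : realType) A of NormedModule R[i] A := {
  cstar_mul : A -> A -> A ;
  cstar_one : A ;
  star : A -> A ;
  cstar_mulA : associative cstar_mul ;
  cstar_mul1l : left_id cstar_one cstar_mul ;
  cstar_mul1r : right_id cstar_one cstar_mul ;
  cstar_mulDl : left_distributive cstar_mul +%R ;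
  cstar_mulDr : right_distributive cstar_mul +%R ;
  cstar_scaleAl : forall (z : R[i]) (a b : A),
    z *: cstar_mul a b = cstar_mul (z *: a) b ;
  cstar_scaleAr : forall (z : R[i]) (a b : A),
    z *: cstar_mul a b = cstar_mul a (z *: b) ;
  cstar_normM : forall a b : A, `|cstar_mul a b| <= `|a| * `|b| ;
  starK : involutive star ;
  star_linear : forall (z : R[i]) (a b : A),
    star (z *: a + b) = Num.conj z *: star a + star b ;
  starM : forall a b : A, star (cstar_mul a b) = cstar_mul (star b) (star a) ;
  cstar_identity : forall a : A, `|cstar_mul (star a) a| = `|a| ^+ 2 }.

#[short(type="cstarAlgType")]
HB.structure Definition CStarAlgebra (R : realType) :=
  {A of CompleteNormedModule R[i] A & isCStarAlgebra R A}.

#[non_forgetful_inheritance]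
HB.instance Definition _ (R : realType) (A : cstarAlgType R) :=
  GRing.Zmodule_isPzRing.Build A
    (@cstar_mulA R A) (@cstar_mul1l R A) (@cstar_mul1r R A)
    (@cstar_mulDl R A) (@cstar_mulDr R A).

(* The inner product is linear in its first argument. *)
HB.mixin Record isHilbert (R : realType) H of NormedModule R[i] H := {
  inner : {dot H for (@Num.conj R[i])} ;
  inner_norm : forall x : H, inner x x = `|x| ^+ 2 }.

#[short(type="hilbertType")]
HB.structure Definition Hilbert (R : realType) :=
  {H of CompleteNormedModule R[i] H & isHilbert R H}.

Section BoundedOperators.
Variables (R : realType) (H : hilbertType R).

Definition is_bounded_operator (f : H -> H) : Prop :=
  linear f /\ exists M : R[i], forall x, `|f x| <= M * `|x|.

Definition bounded_operator_pred : pred (H -> H) :=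
  fun f => `[< is_bounded_operator f >].

Record bounded_operator := BoundedOperator {
  bounded_operator_fun :> H -> H ;
  bounded_operatorP : bounded_operator_pred bounded_operator_fun }.

HB.instance Definition _ := [isSub for bounded_operator_fun].
HB.instance Definition _ := [Choice of bounded_operator by <:].

Lemma bounded_operator_closed : subsemimod_closed bounded_operator_pred.
Proof.
have memP f : reflect (is_bounded_operator f) (f \in bounded_operator_pred).
  exact: asboolP.
split; first split.
- apply/memP; split=> [z x y|]; first by rewrite scaler0 addr0.
  by exists 0 => x; rewrite normr0 mul0r.
- move=> f g /memP[flin [M fM]] /memP[glin [N gN]].
  apply/memP; split=> [z x y|].
    by rewrite !fctE flin glin scalerDr addrACA.
  exists (M + N) => x; rewrite mulrDl.
  exact: le_trans (ler_normD _ _) (lerD (fM x) (gN x)).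
- move=> z f /memP[flin [M fM]]; apply/memP; split=> [w x y|].
    by rewrite !scalrfctE flin scalerDr !scalerA mulrC.
  exists (`|z| * M) => x.
  by rewrite scalrfctE normrZ -mulrA ler_wpM2l.
Qed.

HB.instance Definition _ :=
  GRing.SubChoice_isSubLmodule.Build R[i] (H -> H) bounded_operator_pred
    bounded_operator bounded_operator_closed.

End BoundedOperators.

(* Norms of normed modules over R[i] are R[i]-valued; this is the norm in R. *)
Definition rnorm (R : realType) (V : normedModType R[i]) (x : V) : R :=
  complex.Re `|x|.

Section CStarMatrices.
Variables (R : realType) (A : cstarAlgType R) (t : nat).

Definition mxstar (X : 'M[A]_t) : 'M[A]_t := (map_mx star X)^T.

Definition mxpos (X : 'M[A]_t) : Prop := exists Y : 'M[A]_t, X = mxstar Y *m Y.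

(* The norm of the Hilbert A-module A^t, with A-valued inner product
   <v, w> = \sum_i (v_i)^* w_i. *)
Definition colnorm (v : 'cV[A]_t) : R :=
  Num.sqrt (rnorm (\sum_(i < t) star (v i 0) * v i 0)).

(* The C*-norm of M_t(A): the operator norm of X acting on the Hilbert
   A-module A^t by left multiplication. *)
Definition mxnorm (X : 'M[A]_t) : \bar R :=
  ereal_sup [set (colnorm (X *m v))%:E | v in [set v | colnorm v <= 1]].

End CStarMatrices.

Definition opnorm (R : realType) (H : hilbertType R) (T : bounded_operator H)
    : \bar R :=
  ereal_sup [set (rnorm (T x))%:E | x in [set x | rnorm x <= 1]].

(* M_t(B(H)) is identified with B(H^t), where H^t is the Hilbert space of
   t-tuples of vectors: this defines its order and its norm. *)
Section OperatorMatrices.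
Variables (R : realType) (H : hilbertType R) (t : nat).
Implicit Types (T : 'M[bounded_operator H]_t) (x : 'I_t -> H).

Definition opmx_app T x : 'I_t -> H := fun i => \sum_(j < t) T i j (x j).

Definition tupinner x y : R[i] := \sum_(i < t) inner (x i) (y i).

Definition tupnorm x : R := Num.sqrt (\sum_(i < t) rnorm (x i) ^+ 2).

(* In R[i], [0 <= z] says that z is real and nonnegative. *)
Definition opmx_pos T : Prop := forall x, 0 <= tupinner (opmx_app T x) x.

Definition opmx_norm T : \bar R :=
  ereal_sup [set (tupnorm (opmx_app T x))%:E | x in [set x | tupnorm x <= 1]].

End OperatorMatrices.

(* A^k is 'I_k -> A; the l-th argument a_l is [a i] with i = l - 1, so that
   [rev_ord] exchanges the indices l and k + 1 - l. *)
Section MultilinearMaps.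
Variables (R : realType) (A : cstarAlgType R) (H : hilbertType R) (k : nat).
Implicit Type phi : ('I_k -> A) -> bounded_operator H.

Definition update (a : 'I_k -> A) (i : 'I_k) (x : A) : 'I_k -> A :=
  fun j => if j == i then x else a j.

Definition multilinear phi : Prop :=
  forall (a : 'I_k -> A) (i : 'I_k) (z : R[i]) (x y : A),
    phi (update a i (z *: x + y)) =
    z *: phi (update a i x) + phi (update a i y).

(* The i-th and (k + 1 - i)-th arguments are affected for
   1 <= i <= floor(k / 2), which is m - 1 if k = 2m - 1 and m if k = 2m; the
   other values of c are not used. *)
Definition invariant_map phi : Prop :=
  forall a c : 'I_k -> A,
    phi (fun i => if (i < k./2)%N then a i * c i else a i) =
    phi (fun i => if (rev_ord i < k./2)%N then c (rev_ord i) * a i else a i).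

(* The tuple (r_0, ..., r_k) lists the matrix indices, with r_0 = i and
   r_k = j fixed. *)
Definition amplification (t : nat) phi (X : 'I_k -> 'M[A]_t)
    : 'M[bounded_operator H]_t :=
  \matrix_(i, j)
    \sum_(r : {ffun 'I_k.+1 -> 'I_t} | (r ord0 == i) && (r ord_max == j))
      phi (fun l => X l (r (widen_ord (leqnSn k) l)) (r (lift ord0 l))).

(* For odd k the middle argument a_m is the one of index k./2 = m - 1. *)
Definition amplification_positive (t : nat) phi : Prop :=
  forall X : 'I_k -> 'M[A]_t,
    (forall l, X l = mxstar (X (rev_ord l))) ->
    (odd k -> forall l : 'I_k, l = k./2 :> nat -> mxpos (X l)) ->
    opmx_pos (amplification phi X).

Definition completely_positive phi : Prop :=
  forall t : nat, (0 < t)%N -> amplification_positive t phi.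

Definition amplification_norm (t : nat) phi : \bar R :=
  ereal_sup [set opmx_norm (amplification phi X)
    | X in [set X : 'I_k -> 'M[A]_t | forall l, (mxnorm (X l) <= 1)%E]].

Definition cb_norm phi : \bar R :=
  ereal_sup [set amplification_norm t phi | t in [set t : nat | (0 < t)%N]].

End MultilinearMaps.

(* Main.v *)
(* Invariance gives [phi a = Psi (a_1 a_k, a_2 a_(k-1), ...)], and complete
   positivity makes [g (b, x) (c, y) = <Psi (c^* b) x, y>] a positive
   semidefinite kernel on [A^m * H].  On formal sums of such pairs, left
   multiplication in the i-th coordinate gives commuting *-representations
   [pi_i] of [A], and [phi_t (X_1, ..., X_k)] is the compression to [H^t] of
   [pi_1(X_1) pi_2(X_2) ... pi_2(X_(k-1)) pi_1(X_k)].  The compression has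
   norm [`|Psi 1| = `|phi (1, ..., 1)|], so it suffices that each [pi_i(X)]
   is contractive for [`|X| <= 1]: with [f Z = <pi_i(Z) xi, xi>], iterating
   Cauchy-Schwarz gives
   [f(X^* X)^(2^n) <= f(1)^(2^n - 1) f((X^* X)^(2^n))], where the last factor
   is bounded in [n] since [X^* X] is a contraction of the Hilbert module
   [A^t].  The bounds on Hilbert modules need that sums of [x^* x] are
   positive, which rests on square roots of [1 - b] for [`|b| < 1]. *)
Require Import Defs.
From mathcomp Require Import all_boot all_order all_algebra.
From mathcomp Require Import sesquilinear complex.
From mathcomp Require Import all_classical all_reals all_analysis.
From mathcomp Require Import ring lra zify.

Set Implicit Arguments.
Unset Strict Implicit.
Unset Printing Implicit Defensive.

Import Order.TTheory GRing.Theory Num.Theory.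
Import numFieldNormedType.Exports.

Local Open Scope classical_set_scope.
Local Open Scope complex_scope.
Local Open Scope ring_scope.

(** * Norms and square roots in a C*-algebra *)

Section RealNorm.
Variables (R : realType) (V : normedModType R[i]).
Implicit Types (x y : V) (r : R).

Lemma normr_rnorm x : `|x| = (rnorm x)%:C.
Proof. by rewrite /rnorm RRe_real // normr_real. Qed.

Lemma rnorm_ge0 x : 0 <= rnorm x.
Proof. by rewrite -ler0c -normr_rnorm. Qed.

Lemma rnormD x y : rnorm (x + y) <= rnorm x + rnorm y.
Proof. by rewrite -lecR rmorphD /= -!normr_rnorm ler_normD. Qed.

Lemma rnormN x : rnorm (- x) = rnorm x.
Proof. by rewrite /rnorm normrN. Qed.

Lemma rnormB x y : rnorm (x - y) <= rnorm x + rnorm y.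
Proof. by rewrite -(rnormN y) rnormD. Qed.

Lemma rnorm0 : rnorm (0 : V) = 0.
Proof. by rewrite /rnorm normr0. Qed.

Lemma rnormZ (z : R[i]) x : rnorm (z *: x) = complex.Re `|z| * rnorm x.
Proof.
apply: complexI; rewrite -normr_rnorm normrZ normr_rnorm rmorphM /=.
by rewrite RRe_real // normr_real.
Qed.

Lemma rnormZr r x : rnorm (r%:C *: x) = `|r| * rnorm x.
Proof. by rewrite rnormZ normc_def /= expr0n addr0 sqrtr_sqr. Qed.

Lemma rnorm_eq0 x : rnorm x = 0 -> x = 0.
Proof. by move=> x0; apply/eqP; rewrite -normr_eq0 normr_rnorm x0. Qed.
End RealNorm.

Section CStar.
Variables (R : realType) (A : cstarAlgType R).
Implicit Types (a b c d x y : A) (r s : R) (z : R[i]).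

Lemma cscalerAl z a b : z *: (a * b) = (z *: a) * b.
Proof. exact: cstar_scaleAl. Qed.

Lemma cscalerAr z a b : z *: (a * b) = a * (z *: b).
Proof. exact: cstar_scaleAr. Qed.

Lemma rnormM a b : rnorm (a * b) <= rnorm a * rnorm b.
Proof. by rewrite -lecR rmorphM /= -!normr_rnorm; apply: cstar_normM. Qed.

Lemma rnorm_starM a : rnorm (star a * a) = rnorm a ^+ 2.
Proof.
by apply: complexI; rewrite rmorphXn /= -!normr_rnorm; apply: cstar_identity.
Qed.

Lemma starD a b : star (a + b) = star a + star b.
Proof. by have := star_linear 1 a b; rewrite !scale1r rmorph1 scale1r. Qed.

Lemma star0 : star (0 : A) = 0.
Proof. by apply: (addrI (star 0)); rewrite -starD !addr0. Qed.

Lemma starZ z a : star (z *: a) = Num.conj z *: star a.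
Proof. by have := star_linear z a 0; rewrite !addr0 star0 addr0. Qed.

Lemma starZr r a : star (r%:C *: a) = r%:C *: star a.
Proof. by rewrite starZ -[Num.conj _]/(conjc _) conjc_real. Qed.

Lemma starN a : star (- a) = - star a.
Proof. by apply/eqP; rewrite -addr_eq0 -starD addNr star0. Qed.

Lemma starB a b : star (a - b) = star a - star b.
Proof. by rewrite starD starN. Qed.

Lemma starMr a b : star (a * b) = star b * star a.
Proof. exact: starM. Qed.

Lemma star1 : star (1 : A) = 1.
Proof. by rewrite -[LHS]mulr1 -{2}(starK 1) -starMr mulr1 starK. Qed.

Lemma starX a n : star (a ^+ n) = star a ^+ n.
Proof.
by elim: n => [|n IH]; rewrite ?expr0 ?star1 // exprS starMr IH exprSr.
Qed.

Lemma star_sum I (s : seq I) (P : pred I) (F : I -> A) :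
  star (\sum_(i <- s | P i) F i) = \sum_(i <- s | P i) star (F i).
Proof. by apply: (big_morph star starD star0). Qed.

Lemma rnorm_star a : rnorm (star a) = rnorm a.
Proof.
suff le b : rnorm b <= rnorm (star b).
  by apply/eqP; rewrite eq_le le -{2}(starK a) le.
have [->|b0] := eqVneq (rnorm b) 0; first exact: rnorm_ge0.
have b_gt0 : 0 < rnorm b by rewrite lt_neqAle eq_sym b0 rnorm_ge0.
by rewrite -(ler_pM2r b_gt0) -expr2 -rnorm_starM rnormM.
Qed.

(** The C*-identity makes [rnorm 1] equal to its own square. It is 0 in the zero algebra, which is
    allowed, so only an inequality holds. *)
Lemma rnorm1_le1 : rnorm (1 : A) <= 1.
Proof.
have := rnorm_starM 1; rewrite star1 mulr1 => e.
by have := rnorm_ge0 (1 : A); nra.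
Qed.

Lemma rnormX2 a n : star a = a -> rnorm (a ^+ (2 ^ n)) = rnorm a ^+ (2 ^ n).
Proof.
move=> sa; elim: n => [|n IH]; first by rewrite expn0 !expr1.
have -> : a ^+ (2 ^ n.+1) = star (a ^+ (2 ^ n)) * (a ^+ (2 ^ n)).
  by rewrite starX sa -exprD expnS mul2n addnn.
by rewrite rnorm_starM IH -exprM expnS mulnC.
Qed.

Local Notation sc r := (r%:C *: (1 : A)).

Lemma rnorm_sc r : rnorm (sc r) <= `|r|.
Proof. by rewrite rnormZr ler_piMr // rnorm1_le1. Qed.

Lemma star_sc r : star (sc r) = sc r.
Proof. by rewrite starZr star1. Qed.

Lemma scD r s : sc (r + s) = sc r + sc s.
Proof. by rewrite rmorphD scalerDl. Qed.

Lemma mulsc r a : sc r * a = r%:C *: a.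
Proof. by rewrite -cscalerAl mul1r. Qed.

Lemma mulrsc r a : a * sc r = r%:C *: a.
Proof. by rewrite -cscalerAr mulr1. Qed.

End CStar.

Lemma expr_lt_eps (R : realType) (q e : R) : 0 <= q -> q < 1 -> 0 < e ->
  exists n, q ^+ n < e.
Proof.
move=> q0 q1 e0; have : q ^+ n @[n --> \oo] --> 0.
  by apply: cvg_expr; rewrite ger0_norm.
move=> /cvgrPdist_lt /(_ _ e0) [n _ /(_ n (leqnn n))] /=.
by rewrite sub0r normrN ger0_norm ?exprn_ge0 //; exists n.
Qed.

Lemma geometric_cvg (R : realType) (V : completeNormedModType R[i])
    (u : nat -> V) (q : R) : 0 <= q -> q < 1 ->
  (forall n, rnorm (u n.+1 - u n) <= q ^+ n) ->
  exists l, forall e, 0 < e ->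
    exists n, forall k, (n <= k)%N -> rnorm (l - u k) < e.
Proof.
move=> q0 q1 uq.
have tail m n : rnorm (u (n + m)%N - u n) <= q ^+ n / (1 - q).
  suff : rnorm (u (n + m)%N - u n) <= q ^+ n * (1 - q ^+ m) / (1 - q).
    move=> /le_trans; apply; rewrite ler_pM2r ?invr_gt0 ?subr_gt0 //.
    by rewrite ler_piMr ?exprn_ge0 // lerBlDr lerDl exprn_ge0.
  elim: m => [|m IH].
    by rewrite addn0 subrr rnorm0 expr0 subrr mulr0 mul0r.
  rewrite -(subrK (u (n + m)%N) (u (n + m.+1)%N)) -addrA addnS.
  apply: le_trans (rnormD _ _) (le_trans (lerD (uq _) IH) _).
  rewrite le_eqVlt; apply/orP; left; apply/eqP.
  by rewrite exprD exprS; field; rewrite subr_eq0 eq_sym lt_eqF.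
have small e : 0 < e -> exists n, forall m, rnorm (u n - u (n + m)%N) < e.
  move=> e0; have [|n hn] := @expr_lt_eps _ q (e * (1 - q)) q0 q1.
    by rewrite mulr_gt0 // subr_gt0.
  exists n => m; rewrite -rnormN opprB; apply: le_lt_trans (tail m n) _.
  by rewrite ltr_pdivrMr // subr_gt0.
have ballE (x y : V) (e : R[i]) :
    0 < e -> rnorm (x - y) < complex.Re e -> ball x e y.
  move=> e0 h; rewrite -ball_normE /ball_ /= normr_rnorm.
  by rewrite -(RRe_real (gtr0_real e0)) ltcR.
have Rpos (e : R[i]) : 0 < e -> 0 < complex.Re e.
  by move=> e0; rewrite -ltcR RRe_real // gtr0_real.
have /cauchy_cvgP/cvg_ex[l ul] : cauchy (u @ \oo).
  apply: cauchy_exP => e e0; have [n hn] := small _ (Rpos _ e0).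
  by exists (u n), n => // k /= nk; apply: ballE => //; rewrite -(subnKC nk).
exists l => e e0.
have := ul; move=> /cvgrPdist_lt /(_ e%:C); rewrite ltcR => /(_ e0) [n _ h].
by exists n => k nk; have := h k nk; rewrite /= normr_rnorm ltcR.
Qed.

Lemma ler_eps (R : realType) (x y C : R) :
  (forall e, 0 < e -> x <= y + C * e) -> x <= y.
Proof.
move=> h; apply/ler_addgt0Pr => e e0.
have C1 : 0 < `|C| + 1 by rewrite ltr_wpDl.
have := h (e / (`|C| + 1)); rewrite divr_gt0 // => /(_ isT) /le_trans; apply.
rewrite lerD2l mulrA ler_pdivrMr //; have := ler_norm C; nra.
Qed.

Section Sqrt.
Variables (R : realType) (A : cstarAlgType R).
Implicit Types (a b c d x y : A) (r s : R) (z : R[i]).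

(** The equation [1 - b = (1 - l)^2] is the fixed-point equation [l = (b + l^2) / 2]. Iterating from
    0 gives polynomials in [b], so the limit [l] is self-adjoint and commutes with whatever commutes
    with [b]; the root is [c = 1 - l]. *)
Lemma sqrt_exists b : star b = b -> rnorm b < 1 -> exists c,
  [/\ star c = c, 1 - b = c * c & forall d, d * b = b * d -> d * c = c * d].
Proof.
(* [rho] is the smaller root of [rho = (rnorm b + rho^2) / 2]: the iteration preserves the ball of
   radius [rho < 1] and is [rho]-Lipschitz on it. *)
move=> sb b1; pose rho : R := 1 - Num.sqrt (1 - rnorm b).
have bge := rnorm_ge0 b.
have sq : Num.sqrt (1 - rnorm b) ^+ 2 = 1 - rnorm b by rewrite sqr_sqrtr; lra.
have sqgt : 0 < Num.sqrt (1 - rnorm b) by rewrite sqrtr_gt0; lra.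
have rho1 : rho < 1 by rewrite /rho; lra.
have rho0 : 0 <= rho by rewrite /rho; nra.
have rhoE : rnorm b = 2 * rho - rho ^+ 2 by rewrite /rho; nra.
pose y := fix F n := if n is m.+1 then (2^-1)%:C *: (b + F m * F m) else 0.
have yE n : y n.+1 = (2^-1)%:C *: (b + y n * y n) by [].
have ybd n : rnorm (y n) <= rho.
  elim: n => [|n IH]; first by rewrite rnorm0.
  rewrite yE rnormZr ger0_norm ?invr_ge0 //.
  have := rnormD b (y n * y n); have := rnormM (y n) (y n).
  have := rnorm_ge0 (y n); nra.
have sqdiff c d : rnorm c <= rho -> rnorm d <= rho ->
    rnorm ((2^-1)%:C *: (c * c - d * d)) <= rho * rnorm (c - d).
  move=> hc hd; have -> : c * c - d * d = c * (c - d) + (c - d) * d.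
    by rewrite mulrBr mulrBl addrA subrK.
  rewrite rnormZr ger0_norm ?invr_ge0 //.
  have := rnormD (c * (c - d)) ((c - d) * d).
  have := rnormM c (c - d); have := rnormM (c - d) d.
  have := rnorm_ge0 (c - d); nra.
have step n : rnorm (y n.+1 - y n) <= rho ^+ n.
  elim: n => [|n IH].
    have := ybd 1%N; rewrite subr0 expr0; lra.
  rewrite yE [y n.+1 in X in _ - X]yE -scalerBr opprD addrACA subrr add0r exprS.
  by apply: le_trans (sqdiff _ _ (ybd _) (ybd _)) _; rewrite ler_wpM2l.
have [l hl] := geometric_cvg rho0 rho1 step.
(* Each property of [l] is an identity whose defect is bounded by the distances from [l] to two
   consecutive iterates, hence vanishes. *)
have eq0 (x : A) (C : R) : 0 <= C ->
    (forall n, rnorm x <= C * (rnorm (l - y n) + rnorm (l - y n.+1))) -> x = 0.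
  move=> C0 h; apply: rnorm_eq0; apply/eqP; rewrite eq_le rnorm_ge0 andbT.
  apply: (@ler_eps _ _ _ (2 * C)) => e e0; have [n hn] := hl _ e0.
  have := h n; have := hn _ (leqnn n); have := hn _ (leqnSn n); nra.
have lbd : rnorm l <= rho.
  apply: (@ler_eps _ _ _ 1) => e e0; have [n hn] := hl _ e0.
  have := hn _ (leqnn n); have := rnormD (l - y n) (y n); have := ybd n.
  rewrite subrK; lra.
have sy n : star (y n) = y n.
  by elim: n => [|n IH]; rewrite ?star0 // yE starZr starD sb starMr IH.
have ycomm d n : d * b = b * d -> d * y n = y n * d.
  move=> db; elim: n => [|n IH]; first by rewrite mulr0 mul0r.
  rewrite yE -cscalerAr -cscalerAl mulrDr mulrDl db; congr (_ *: (_ + _)).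
  by rewrite mulrA IH -mulrA IH mulrA.
have dge n := rnorm_ge0 (l - y n).
have sl : star l = l.
  apply/eqP; rewrite -subr_eq0; apply/eqP; apply: (@eq0 _ 2) => // n.
  have -> : star l - l = star (l - y n) - (l - y n).
    by rewrite starB sy opprB addrA subrK.
  have := rnormB (star (l - y n)) (l - y n); have := dge n.+1.
  rewrite rnorm_star; lra.
have lE : l = (2^-1)%:C *: (b + l * l).
  apply/eqP; rewrite -subr_eq0; apply/eqP; apply: (@eq0 _ 1) => // n.
  have -> : l - (2^-1)%:C *: (b + l * l) =
      (l - y n.+1) - (2^-1)%:C *: (l * l - y n * y n).
    rewrite yE -[in RHS]addrA -opprD -scalerDr; congr (_ - _ *: _).
    by rewrite addrCA addrK addrC.
  have := rnormB (l - y n.+1) ((2^-1)%:C *: (l * l - y n * y n)).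
  have := sqdiff _ _ lbd (ybd n); have := dge n; nra.
exists (1 - l); split.
- by rewrite starB star1 sl.
- have -> : b = l + l - l * l.
    rewrite {1 2}lE -scalerDl -rmorphD /= -[X in X + X]mul1r -mulrDl mulfV //.
    by rewrite scale1r addrK.
  by rewrite mulrBl mul1r mulrBr mulr1 -[l + l - _]addrA opprD addrA.
- move=> d db; rewrite mulrBr mulrBl mulr1 mul1r; congr (_ - _).
  apply/eqP; rewrite -subr_eq0; apply/eqP.
  apply: (@eq0 _ (2 * rnorm d)) => [|n]; first by rewrite mulr_ge0 ?rnorm_ge0.
  have -> : d * l - l * d = d * (l - y n) - (l - y n) * d.
    by rewrite mulrBr mulrBl (ycomm _ _ db) opprB addrA subrK.
  have := rnormB (d * (l - y n)) ((l - y n) * d).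
  have := rnormM d (l - y n); have := rnormM (l - y n) d.
  have := rnorm_ge0 d; have := dge n.+1; nra.
Qed.
End Sqrt.

(** * The positive cone *)

Section Cone.
Variables (R : realType) (A : cstarAlgType R).
Implicit Types (a b c d h u v x y : A) (r s e : R) (z : R[i]).

Local Notation sc r := ((r)%:C *: (1 : A)).

(* Positivity without spectral theory: [a] lies in a ball of radius [r]
   centred at [r]. *)
Definition nneg a := star a = a /\ exists r, rnorm (sc r - a) <= r.

Lemma rnorm_sa_sq h : star h = h -> rnorm (h * h) = rnorm h ^+ 2.
Proof. by move=> sh; rewrite -rnorm_starM sh. Qed.

(* [u = h + i c] satisfies [u^* u = r], and [c] is its imaginary part. *)
Lemma rnorm_sq_sum_le h c r : star h = h -> star c = c -> h * c = c * h ->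
  h * h + c * c = sc r -> rnorm c ^+ 2 <= `|r|.
Proof.
move=> sh sc' hc e; pose u := h + 'i%C *: c.
have su : star u = h - 'i%C *: c.
  rewrite starD starZ sh sc' -[Num.conj _]/(conjc _); congr (_ + _).
  rewrite -scaleNr; congr (_ *: _); apply/eqP.
  by rewrite eq_complex /= oppr0 !eqxx.
have uu : star u * u = sc r.
  rewrite su mulrBl !mulrDr -!cscalerAr -!cscalerAl hc scalerA -e.
  have -> : 'i%C * 'i%C = -1 :> R[i] by rewrite -expr2 sqr_i.
  by rewrite scaleN1r opprD opprK addrA addrK.
have ub : rnorm u ^+ 2 <= `|r| by rewrite -rnorm_starM uu rnorm_sc.
have cu : 2 * rnorm c <= 2 * rnorm u.
  have <- : rnorm (u - star u) = 2 * rnorm c.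
    have -> : u - star u = ('i%C + 'i%C) *: c.
      by rewrite su /u opprB ['i%C *: c - h]addrC addrACA subrr add0r -scalerDl.
    rewrite rnormZ normc_def /= addr0 expr0n add0r sqrtr_sqr ger0_norm //.
  by have := rnormB u (star u); rewrite rnorm_star; lra.
have := rnorm_ge0 c; nra.
Qed.

(** [r - h^2] is the square of a self-adjoint [c'] commuting with [h], namely [sqrt r] times the
    root of [1 - h^2 / r]. Hence [h^2 + c'^2 = r], and [rnorm_sq_sum_le] bounds [c']. *)
Lemma rnorm_sc_sub_sq h r : star h = h -> rnorm h ^+ 2 < r ->
  rnorm (sc r - h * h) <= r.
Proof.
move=> sh hr; have r0 : 0 < r.
  by apply: le_lt_trans hr; rewrite exprn_ge0 ?rnorm_ge0.
pose b := (r^-1)%:C *: (h * h).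
have [||c [sc' bc cc]] := @sqrt_exists R A b.
- by rewrite starZr starMr sh.
- rewrite rnormZr ger0_norm ?invr_ge0 1?ltW // rnorm_sa_sq //.
  by rewrite mulrC ltr_pdivrMr // mul1r.
have hc : h * c = c * h.
  by apply: cc; rewrite -cscalerAr -cscalerAl mulrA.
have e : sc r - h * h = r%:C *: (c * c).
  by rewrite -bc scalerBr /b scalerA -rmorphM mulfV ?gt_eqF // scale1r.
pose c' := (Num.sqrt r)%:C *: c.
have c'E : c' * c' = r%:C *: (c * c).
  by rewrite -cscalerAl -cscalerAr scalerA -rmorphM -expr2 sqr_sqrtr // ltW.
have := @rnorm_sq_sum_le h c' r sh.
rewrite starZr sc' -cscalerAl -cscalerAr hc => /(_ erefl erefl).
rewrite c'E -e addrCA subrr addr0 => /(_ erefl).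
by rewrite -rnorm_sa_sq ?c'E -?e ?starZr ?sc' // gtr0_norm.
Qed.

Lemma nneg_sq h : star h = h -> nneg (h * h).
Proof.
move=> sh; split; first by rewrite starMr sh.
by exists (rnorm h ^+ 2 + 1); rewrite rnorm_sc_sub_sq // ltrDl.
Qed.

Lemma nnegD a b : nneg a -> nneg b -> nneg (a + b).
Proof.
move=> [sa [r ar]] [sb [s bs]]; split; first by rewrite starD sa sb.
by exists (r + s); rewrite scD opprD addrACA (le_trans (rnormD _ _)) // lerD.
Qed.

Lemma nneg0 : nneg 0.
Proof. by split; [rewrite star0 | exists 0; rewrite subr0 scale0r rnorm0]. Qed.

Lemma nnegZ r a : 0 <= r -> nneg a -> nneg (r%:C *: a).
Proof.
move=> r0 [sa [s as']]; split; first by rewrite starZr sa.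
exists (r * s); rewrite rmorphM -scalerA -scalerBr rnormZr ger0_norm //.
by rewrite ler_wpM2l.
Qed.

Lemma nneg_sc r : 0 <= r -> nneg (sc r).
Proof.
by move=> r0; split; [rewrite star_sc | exists r; rewrite subrr rnorm0].
Qed.

(** [a + e] is [r + e] times [1 - b] with [b = (r - a) / (r + e)]. The shift by [e] makes
    [rnorm b < 1], as [sqrt_exists] requires. *)
Lemma nneg_sqrt a e : nneg a -> 0 < e -> exists h,
  [/\ star h = h, a + sc e = h * h & forall d, d * a = a * d -> d * h = h * d].
Proof.
move=> [sa [r ar]] e0; have r0 : 0 <= r := le_trans (rnorm_ge0 _) ar.
have re0 : 0 < r + e by rewrite ltr_wpDl.
pose b := ((r + e)^-1)%:C *: (sc r - a).
have [||c [sc' bc cc]] := @sqrt_exists R A b.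
- by rewrite starZr starB star_sc sa.
- rewrite rnormZr gtr0_norm ?invr_gt0 // mulrC ltr_pdivrMr // mul1r.
  by rewrite (le_lt_trans ar) // ltrDl.
exists ((Num.sqrt (r + e))%:C *: c); split.
- by rewrite starZr sc'.
- rewrite -cscalerAl -cscalerAr scalerA -rmorphM -expr2 sqr_sqrtr ?ltW // -bc.
  rewrite scalerBr /b scalerA -rmorphM mulfV ?gt_eqF // scale1r scD opprB.
  by rewrite [a - _]addrC addrACA subrr add0r addrC.
- move=> d da; rewrite -cscalerAr -cscalerAl; congr (_ *: _); apply: cc.
  by rewrite -cscalerAr -cscalerAl mulrBr mulrBl mulrsc mulsc da.
Qed.

(** The radius in [nneg] can be any bound of the norm: [a + e = h^2] by [nneg_sqrt], then
    [rnorm_sc_sub_sq] applies to [h], and [e] tends to 0. *)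
Lemma nneg_norm a r : nneg a -> rnorm a <= r -> rnorm (sc r - a) <= r.
Proof.
move=> na ar; apply: (@ler_eps _ _ _ 3) => e e0.
have [h [sh hE _]] := nneg_sqrt na e0.
have := @rnorm_sc_sub_sq h (r + e + e) sh.
rewrite -rnorm_sa_sq // -hE => H.
have -> : sc r - a = (sc (r + e + e) - (a + sc e)) - sc e.
  by rewrite !scD [in RHS]opprD addrA addrAC addrK addrAC addrK.
have {}H : rnorm (sc (r + e + e) - (a + sc e)) <= r + e + e.
  apply: H; have := rnormD a (sc e); have := rnorm_sc A e.
  by rewrite gtr0_norm //; lra.
have := rnormB (sc (r + e + e) - (a + sc e)) (sc e).
by have := rnorm_sc A e; rewrite gtr0_norm //; lra.
Qed.

Lemma nneg_of_norm a r : star a = a -> rnorm a <= r -> nneg (sc r - a).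
Proof.
move=> sa ar; split; first by rewrite starB star_sc sa.
by exists r; rewrite opprB addrCA subrr addr0.
Qed.

(** By [nneg_norm] the radii for the perturbed elements can be chosen to tend to [rnorm a]. This
    removes the shift left by [nneg_sqrt]. *)
Lemma nneg_closed a p : star a = a -> 
  (forall e, 0 < e -> nneg (a + e%:C *: p)) -> nneg a.
Proof.
move=> sa h; split=> //; exists (rnorm a).
apply: (@ler_eps _ _ _ (3 * rnorm p)) => e e0.
have pe : rnorm (e%:C *: p) = e * rnorm p by rewrite rnormZr gtr0_norm.
have := @nneg_norm _ (rnorm a + e * rnorm p) (h e e0).
rewrite (le_trans (rnormD _ _)) ?pe // => /(_ isT) H.
have -> : sc (rnorm a) - a =
    (sc (rnorm a + e * rnorm p) - (a + e%:C *: p)) -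
    (sc (e * rnorm p) - e%:C *: p).
  by rewrite scD opprD addrACA addrK.
apply: le_trans (rnormB _ _) _.
have pp := rnorm_ge0 p.
have : rnorm (sc (e * rnorm p) - e%:C *: p) <= 2 * (e * rnorm p); last by lra.
apply: le_trans (rnormB _ _) _; rewrite pe.
have ep : 0 <= e * rnorm p by rewrite mulr_ge0 // ltW.
by have := rnorm_sc A (e * rnorm p); rewrite ger0_norm //; lra.
Qed.
End Cone.

(** * Products of commuting positive elements and positivity of [x^* x] *)

Section Positive.
Variables (R : realType) (A : cstarAlgType R).
Implicit Types (a b c d h u v x y : A) (r s e : R) (z : R[i]).

Local Notation sc r := ((r)%:C *: (1 : A)).

Lemma scale_half a : (2^-1)%:C *: (a + a) = a.
Proof.
rewrite scalerDr -scalerDl -rmorphD -[X in X + X]mul1r -mulrDl mulfV //.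
by rewrite scale1r.
Qed.

Lemma mulrn_scale a n : a *+ n = n%:R%:C *: a.
Proof. by rewrite rmorph_nat scaler_nat. Qed.

Lemma rnormX a n : rnorm (a ^+ n) <= rnorm a ^+ n.
Proof.
elim: n => [|n IH]; first by rewrite !expr0 rnorm1_le1.
rewrite !exprS; apply: le_trans (rnormM _ _) _.
by rewrite ler_wpM2l ?rnorm_ge0.
Qed.

(** With [a + e = h^2], the root [h] commutes with [k], so [k^2 (a + e) = (k h)^2]; then [e] tends
    to 0. *)
Lemma nneg_sqM k a : star k = k -> k * a = a * k -> nneg a -> nneg (k * k * a).
Proof.
move=> sk ka na; have [sa _] := na.
apply: (@nneg_closed _ _ _ (k * k)) => [|e e0].
  by rewrite !starMr sa sk mulrA -[k * k * a]mulrA ka mulrA ka.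
have [h [sh hE hc]] := nneg_sqrt na e0.
have -> : k * k * a + e%:C *: (k * k) = (k * h) * (k * h).
  rewrite -mulrsc -mulrDr hE -[in RHS]mulrA [h * (k * h)]mulrA -(hc k) //.
  by rewrite !mulrA.
by apply: nneg_sq; rewrite starMr sh sk hc.
Qed.

Lemma nnegM a b : a * b = b * a -> nneg a -> nneg b -> nneg (a * b).
Proof.
move=> ab na nb; have [[sa _] [sb _]] := (na, nb).
apply: (@nneg_closed _ _ _ b) => [|e e0]; first by rewrite starMr sa sb.
have [h [sh hE hc]] := nneg_sqrt na e0.
rewrite -mulsc -mulrDl hE; apply: nneg_sqM => //.
by apply/esym/hc; rewrite ab.
Qed.

Lemma nnegX a n : nneg a -> nneg (a ^+ n).
Proof.
move=> na; elim: n => [|n IH].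
  by have := nneg_sc A (@ler01 R); rewrite scale1r.
by rewrite exprS; apply: nnegM; rewrite // -exprS -exprSr.
Qed.

(** [r^2 - y^2 = (r - y) (r + y)] is positive as a product of commuting positive elements. A root
    [t] of [r^2 - y^2 + e] satisfies [t^2 + y^2 = r^2 + e], and [rnorm_sq_sum_le] bounds [y]. *)
Lemma rnorm_le_of_nneg r y : 0 <= r ->
  star y = y -> nneg (sc r - y) -> nneg (sc r + y) -> rnorm y <= r.
Proof.
move=> r0 sy n1 n2.
have e1 : (sc r - y) * (sc r + y) = sc (r ^+ 2) - y * y.
  rewrite mulrBl !mulrDr mulrsc mulsc mulrsc scalerA -rmorphM -expr2.
  by rewrite opprD addrA addrK.
have n3 : nneg (sc (r ^+ 2) - y * y).
  rewrite -e1; apply: nnegM => //; rewrite e1 mulrDl !mulrBr mulrsc mulsc.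
  by rewrite mulrsc scalerA -rmorphM -expr2 addrA subrK.
suff : rnorm y ^+ 2 <= r ^+ 2 by rewrite ler_sqr // nnegrE rnorm_ge0.
apply: (@ler_eps _ _ _ 1) => e e0; rewrite mul1r.
have [t [st tE tc]] := nneg_sqrt n3 e0.
rewrite -[leRHS]ger0_norm ?addr_ge0 ?exprn_ge0 ?(ltW e0) //.
apply: (@rnorm_sq_sum_le _ _ t) => //.
  by apply/esym/tc; rewrite mulrBr mulrBl mulrsc mulsc mulrA.
by rewrite -tE scD addrAC subrK.
Qed.

(** With [r = rnorm (u + v)], both [u] and [r - u = (r - (u + v)) + v] are positive, so [u - r / 2]
    has norm at most [r / 2]. *)
Lemma rnorm_nneg_le u v : nneg u -> nneg v -> rnorm u <= rnorm (u + v).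
Proof.
move=> nu nv; have [[su _] [sv _]] := (nu, nv).
set r := rnorm (u + v).
have n1 : nneg (sc r - u).
  have : nneg (sc r - (u + v) + v).
    by apply: nnegD nv; apply: nneg_of_norm => //; rewrite starD su sv.
  by rewrite opprD addrA subrK.
have r0 : 0 <= r by apply: rnorm_ge0.
have rr : sc r = sc (r / 2) + sc (r / 2) by rewrite -scD -splitr.
have : rnorm (u - sc (r / 2)) <= r / 2.
  apply: rnorm_le_of_nneg; rewrite ?divr_ge0 ?starB ?star_sc ?su //.
    by rewrite opprB addrA -rr.
  by rewrite addrCA subrr addr0.
have := rnormD (u - sc (r / 2)) (sc (r / 2)); rewrite subrK.
have := rnorm_sc A (r / 2); rewrite ger0_norm ?divr_ge0 //; lra.
Qed.

(* Telescoping in [n]: the difference of two consecutive terms is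
   [n.+1 (1 - u)^2 u^n]. *)
Lemma nneg_bernoulli u n : nneg u ->
  nneg (1 - u ^+ n * (1 + (1 - u) *+ n)).
Proof.
move=> nu; elim: n => [|n IH].
  by rewrite expr0 mulr0n addr0 mul1r subrr; apply: nneg0.
set a := 1 - u; have [su _] := nu.
have ua : u * (1 + a *+ n.+1) + a * a *+ n.+1 = 1 + a *+ n.
  rewrite -[u in LHS](subKr 1) -/a mulrBl mul1r mulrDr mulr1 mulrnAr.
  by rewrite opprD addrA subrK mulrSr addrA addrK.
have -> : 1 - u ^+ n.+1 * (1 + a *+ n.+1) =
    1 - u ^+ n * (1 + a *+ n) + a * a * u ^+ n *+ n.+1.
  have ca : GRing.comm (u ^+ n) (a * a).
    by apply: commrM; apply/commr_sym/commrX/commr_sym; rewrite /GRing.comm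
      mulrBr mulrBl mulr1 mul1r.
  rewrite -ua -ca [in RHS]mulrDr opprD [in RHS]addrA [u ^+ n * (_ *+ _)]mulrnAr.
  by rewrite subrK exprSr mulrA.
apply: nnegD => //; elim: n.+1 => [|m IHm].
  by rewrite mulr0n; apply: nneg0.
rewrite mulrSr; apply: nnegD IHm _; apply: nneg_sqM (nnegX _ nu).
  by rewrite starB star1 su.
by rewrite /a mulrBl mulrBr mul1r mulr1 -exprS -exprSr.
Qed.

(* Twice the sum of the squares of the real and imaginary parts of [x]. *)
Lemma nneg_starM_sum x : nneg (star x * x + x * star x).
Proof.
pose h := x + star x; pose k := 'i%C *: (x - star x).
have sh : star h = h by rewrite starD starK addrC.
have sk : star k = k.
  rewrite starZ starB starK -[Num.conj _]/(conjc _) -opprB scalerN -scaleNr.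
  by congr (_ *: _); apply/eqP; rewrite eq_complex /= oppr0 opprK !eqxx.
have kk : k * k = (x - star x) * (star x - x).
  rewrite -cscalerAl -cscalerAr scalerA -expr2 sqr_i scaleN1r -mulrN opprB //.
have -> : star x * x + x * star x = (2^-1)%:C *: (h * h + k * k).
  rewrite kk /h -[star x - x]opprB mulrN; set s := star x.
  have -> : (x + s) * (x + s) = (x * x + s * s) + (s * x + x * s).
    rewrite mulrDl !mulrDr [s * x + s * s]addrC addrACA.
    by rewrite [x * s + s * x]addrC.
  have -> : (x - s) * (x - s) = (x * x + s * s) - (s * x + x * s).
    by rewrite mulrBl !mulrBr opprB addrACA -opprD [x * s + s * x]addrC.
  by rewrite opprB [_ - (x * x + s * s)]addrC addrACA subrr add0r scale_half.
by apply: nnegZ; rewrite ?invr_ge0 //; apply: nnegD; apply: nneg_sq.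
Qed.

(* If [y^* y <= d] then also [- d <= y y^*], and evaluating [t (t - g)] at both
   bounds [g := `|y^* y| = `|y y^*|]. *)
Lemma rnorm_le_of_upper_bound y (dl : R) : 0 <= dl ->
  nneg (sc dl - star y * y) -> rnorm y ^+ 2 <= 3 * dl.
Proof.
move=> dl0 n1; pose c := star y * y; pose d := y * star y.
set g := rnorm y ^+ 2.
have g0 : 0 <= g by rewrite exprn_ge0 // rnorm_ge0.
have cg : rnorm c = g by rewrite rnorm_starM.
have dg : rnorm d = g by rewrite /d -{1}(starK y) rnorm_starM rnorm_star.
have sc' : star c = c by rewrite starMr starK.
have sd : star d = d by rewrite starMr starK.
have n2 : nneg (d + sc dl).
  have := nnegD n1 (nneg_starM_sum y).
  by rewrite addrA subrK addrC.
have n3 : rnorm (sc g - d) <= g + dl.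
  have := @nneg_norm _ _ _ (g + dl) n2.
  rewrite scD opprD addrACA subrr addr0; apply.
  apply: le_trans (rnormD _ _) _; rewrite dg lerD2l.
  by rewrite (le_trans (rnorm_sc _ _)) // ger0_norm.
(* The identity [c^2 - g c = - y^* (g - d) y] transfers the estimate on [d] to [c]. *)
have n4 : rnorm (c * c - g%:C *: c) <= g * (g + dl).
  have -> : c * c - g%:C *: c = - (star y * ((sc g - d) * y)).
    by rewrite mulrBl mulsc mulrBr -cscalerAr opprB /d /c !mulrA.
  rewrite rnormN; apply: le_trans (rnormM _ _) _; rewrite rnorm_star.
  apply: le_trans (ler_wpM2l (rnorm_ge0 y) (rnormM _ _)) _.
  by rewrite mulrCA -expr2 mulrC ler_wpM2l.
have n5 : nneg (sc g + c).
  have := @nneg_of_norm _ _ (- c) g; rewrite opprK; apply.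
    by rewrite starN sc'.
  by rewrite rnormN cg.
have n6 : nneg ((sc dl - c) * (sc g + c)).
  apply: nnegM => //; rewrite mulrBl mulrBr mulsc mulrsc.
  by rewrite mulrDr mulrDl mulsc mulrsc.
(* Adding the positive product [(dl - c) (g + c)] to [2 c^2] leaves [(c^2 - g c) + dl c + dl g].
   Comparing norms gives [2 g^2 <= g (g + dl) + 2 dl g], whence [g <= 3 dl]. *)
have n7 : nneg (c * c + c * c) by apply: nnegD; apply: nneg_sq.
have := rnorm_nneg_le n7 n6.
have -> : c * c + c * c + (sc dl - c) * (sc g + c) =
    (c * c - g%:C *: c) + (dl%:C *: c + sc (dl * g)).
  rewrite mulrBl !mulrDr mulsc mulrsc mulsc scalerA -rmorphM.
  rewrite opprD [_ + dl%:C *: c]addrC [- _ - _]addrC [X in _ + X]addrC.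
  by rewrite !addrA addrK.
have -> : c * c + c * c = 2%:C *: (c * c).
  by rewrite -mulr2n -scaler_nat; congr (_ *: _); rewrite rmorph_nat.
rewrite rnormZr ger0_norm // rnorm_sa_sq // cg => H.
have := le_trans H (rnormD _ _).
have := rnormD (dl%:C *: c) (sc (dl * g)).
have h1 : rnorm (dl%:C *: c) = dl * g by rewrite rnormZr ger0_norm ?cg.
have h2 : rnorm (sc (dl * g)) <= dl * g.
  have dlg : 0 <= dl * g by rewrite mulr_ge0.
  by have := rnorm_sc A (dl * g); rewrite (ger0_norm dlg).
rewrite h1; nra.
Qed.

(* If [u = 1 - x^* x] had norm [> 1], then [y = x u^q] would give
   [y^* y = u^M - u^(M+1)], [M = 2 q], whose norm is at least [`|u| - 1]
   although [y^* y <= 1 / M]. *)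
Lemma nneg_starM_le1 x : rnorm x <= 1 -> nneg (star x * x).
Proof.
move=> x1; set a := star x * x; pose u := 1 - a.
have sa : star a = a by rewrite starMr starK.
have aE : a = 1 - u by rewrite subKr.
have a1 : rnorm a <= 1.
  by rewrite rnorm_starM; have := rnorm_ge0 x; nra.
have nu : nneg u by have := nneg_of_norm sa a1; rewrite scale1r.
split=> //; exists 1; rewrite scale1r -/u leNgt; apply/negP => u1.
set nu1 := rnorm u in u1.
have bound j : nu1 - 1 <= 3 / (2 ^ j.+1)%:R.
  pose q := (2 ^ j)%N; set M := (2 ^ j.+1)%N.
  have ME : M = (q + q)%N by rewrite /M expnS mul2n addnn.
  have M0 : 0 < M%:R :> R by rewrite ltr0n expn_gt0.
  pose y := x * u ^+ q.
  have yy : star y * y = u ^+ M - u ^+ M.+1.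
    have su : star u = u by case: nu.
    rewrite starMr starX su -mulrA [star x * _]mulrA -/a aE mulrA mulrBr mulr1.
    by rewrite mulrBl -exprSr -!exprD addSn -ME.
  (* [nneg_bernoulli] gives [u^M (1 + M a) <= 1]; adding the positive [u^M] to the difference leaves
     [M u^M a <= 1]. *)
  have n1 : nneg (sc (M%:R^-1) - star y * y).
    have := nnegD (nneg_bernoulli M nu) (nnegX M nu).
    rewrite -aE mulrDr mulr1 opprD addrA addrAC subrK.
    move=> /(@nnegZ _ _ (M%:R^-1)); rewrite invr_ge0 ler0n => /(_ isT).
    rewrite scalerBr mulrnAr mulrn_scale scalerA -rmorphM mulVf ?gt_eqF //.
    rewrite scale1r.
    by rewrite yy aE mulrBr mulr1 -exprSr.
  have := rnorm_le_of_upper_bound _ n1; rewrite invr_ge0 ler0n => /(_ isT).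
  rewrite -rnorm_starM yy; apply: le_trans.
  have h1 : rnorm (u ^+ M.+1) <= rnorm (u ^+ M - u ^+ M.+1) + rnorm (u ^+ M).
    have := rnormB (u ^+ M) (u ^+ M - u ^+ M.+1); rewrite subKr; lra.
  have h2 : nu1 ^+ M.+1 <= rnorm (u ^+ M.+1).
    (* As [u] is self-adjoint, its power of exponent [2 M = 2^(j+2)] has norm exactly [nu1^(2 M)].
       Splitting [2 M = (M + 1) + (M - 1)] turns this into a lower bound for the power [M + 1]. *)
    have h3 : nu1 ^+ M.+1 * nu1 ^+ M.-1 <= rnorm (u ^+ M.+1) * nu1 ^+ M.-1.
      rewrite -exprD addSnnS prednK ?expn_gt0 // addnn -mul2n -expnS.
      rewrite -rnormX2; last by case: nu.
      have -> : (2 ^ j.+2 = M.+1 + M.-1)%N.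
        by rewrite addSnnS prednK ?expn_gt0 // addnn -mul2n -expnS.
      rewrite exprD; apply: le_trans (rnormM _ _) _.
      by rewrite ler_wpM2l ?rnorm_ge0 // rnormX.
    by rewrite ler_pM2r // in h3; rewrite exprn_gt0 // (lt_trans _ u1).
  have h4 := rnormX u M; rewrite -/nu1 in h4.
  have h5 : 1 <= nu1 ^+ M by rewrite exprn_ege1 // ltW.
  rewrite exprS in h2; nra.
have [j hj] : exists j : nat, 3 / (nu1 - 1) < j%:R.
  by exists (Num.truncn (3 / (nu1 - 1))).+1; rewrite truncnS_gt.
have := bound j; rewrite leNgt => /negP; apply.
have d0 : 0 < nu1 - 1 by rewrite subr_gt0.
rewrite ltr_pdivrMr // in hj; rewrite ltr_pdivrMr ?ltr0n ?expn_gt0 // mulrC.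
apply: lt_le_trans hj _; rewrite ler_pM2r // ler_nat.
by apply: ltnW; apply: ltn_trans (ltnSn j) (ltn_expl _ _).
Qed.

(** Rescaling by [s = rnorm x + 1] reduces to norm at most 1; the added 1 keeps [s] invertible at
    [x = 0]. *)
Lemma nneg_starM x : nneg (star x * x).
Proof.
pose s := rnorm x + 1; have s0 : 0 < s by rewrite ltr_wpDl ?rnorm_ge0.
have -> : star x * x = (s ^+ 2)%:C *:
    (star ((s^-1)%:C *: x) * ((s^-1)%:C *: x)).
  rewrite starZr -cscalerAl -cscalerAr !scalerA -!rmorphM.
  have -> : s ^+ 2 * s^-1 * s^-1 = 1 by field; rewrite gt_eqF.
  by rewrite scale1r.
apply: nnegZ; first exact: exprn_ge0 (ltW s0).
apply: nneg_starM_le1; rewrite rnormZr gtr0_norm ?invr_gt0 //.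
by rewrite mulrC ler_pdivrMr // mul1r lerDl.
Qed.
End Positive.

(** * The Hilbert module A^t *)

Section HilbertModule.
Variables (R : realType) (A : cstarAlgType R) (t : nat).
Implicit Types (v w x y : 'cV[A]_t) (X Y : 'M[A]_t) (r : R).

Local Notation sc r := ((r)%:C *: (1 : A)).

Definition hdot v w : A := \sum_(i < t) star (v i 0) * w i 0.

Definition mxcontr X : Prop :=
  forall v, rnorm (hdot (X *m v) (X *m v)) <= rnorm (hdot v v).

Lemma star_hdot v w : star (hdot v w) = hdot w v.
Proof.
by rewrite /hdot star_sum; apply: eq_bigr => i _; rewrite starMr starK.
Qed.

Lemma nneg_sum I (s : seq I) (P : pred I) (F : I -> A) :
  (forall i, P i -> nneg (F i)) -> nneg (\sum_(i <- s | P i) F i).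
Proof.
move=> h.
by apply: (big_ind (@nneg R A)); [exact: nneg0 | exact: nnegD | exact: h].
Qed.

Lemma hdot_mulmx X v w : hdot (mxstar X *m v) w = hdot v (X *m w).
Proof.
rewrite /hdot.
under eq_bigr => i _ do rewrite mxE star_sum mulr_suml.
rewrite exchange_big /=; apply: eq_bigr => j _; rewrite mxE mulr_sumr.
by apply: eq_bigr => i _; rewrite !mxE starMr starK mulrA.
Qed.

Lemma mxstarK X : mxstar (mxstar X) = X.
Proof. by apply/matrixP => i j; rewrite !mxE starK. Qed.

Lemma mxstarM X Y : mxstar (X *m Y) = mxstar Y *m mxstar X.
Proof.
apply/matrixP => i j; rewrite !mxE star_sum; apply: eq_bigr => k _.
by rewrite !mxE starMr.
Qed.

(* With [a = <x, y>] and [z = r y - x a], the element [r^2 <y, y>] is the sum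
   of [r a^* a], [<z, z>] and [a^* (r - <x, x>) a]. *)
Lemma hdot_CauchySchwarz x y r : rnorm (hdot x x) < r ->
  rnorm (hdot x y) ^+ 2 <= r * rnorm (hdot y y).
Proof.
move=> xr; have r0 : 0 < r by apply: le_lt_trans xr; apply: rnorm_ge0.
set a := hdot x y.
have sxx : star (hdot x x) = hdot x x by apply: star_hdot.
have [h [sh hE _]] : exists h, [/\ star h = h, sc r - hdot x x = h * h &
    forall d, d * (sc (rnorm (hdot x x)) - hdot x x) =
              (sc (rnorm (hdot x x)) - hdot x x) * d -> d * h = h * d].
  have [|h [sh hE hc]] :=
      nneg_sqrt (nneg_of_norm sxx (lexx _)) (e := r - rnorm (hdot x x)).
    by rewrite subr_gt0.
  by exists h; split=> //; rewrite -hE addrAC -scD subrKC.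
pose z i := r%:C *: y i 0 - x i 0 * a.
have zz : \sum_i star (z i) * z i = (r ^+ 2)%:C *: hdot y y -
    r%:C *: (star a * a) - (r%:C *: (star a * a) - star a * hdot x x * a).
  transitivity (\sum_i ((r ^+ 2)%:C *: (star (y i 0) * y i 0) -
      r%:C *: (star (y i 0) * x i 0 * a) -
      (r%:C *: (star a * (star (x i 0) * y i 0)) -
       star a * (star (x i 0) * x i 0) * a))).
    apply: eq_bigr => i _; rewrite /z starB starZr starMr mulrBl !mulrBr.
    by rewrite -!cscalerAl -!cscalerAr scalerA -rmorphM -expr2 !mulrA.
  rewrite !sumrB -!scaler_sumr -!mulr_suml -!mulr_sumr -/(hdot x x).
  by rewrite -/(hdot y y) -/(hdot y x) -/(hdot x y) -/a -(star_hdot x y).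
have key : (r ^+ 2)%:C *: hdot y y = r%:C *: (star a * a) +
   (\sum_i star (z i) * z i + star (h * a) * (h * a)).
  have -> : star (h * a) * (h * a) =
      r%:C *: (star a * a) - star a * hdot x x * a.
    rewrite starMr sh mulrA -[star a * h * h]mulrA -hE mulrBr mulrBl.
    by rewrite mulrsc -cscalerAl.
  by rewrite zz subrK addrC subrK.
have n1 : nneg (r%:C *: (star a * a)).
  by apply: nnegZ (ltW r0) _; apply: nneg_starM.
have n2 : nneg (\sum_i star (z i) * z i + star (h * a) * (h * a)).
  apply: nnegD (nneg_starM _); apply: nneg_sum => i _; exact: nneg_starM.
have := rnorm_nneg_le n1 n2.
rewrite -key !rnormZr rnorm_starM !gtr0_norm ?exprn_gt0 //.
by rewrite [r ^+ 2]expr2 -mulrA ler_pM2l.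
Qed.

(** Dividing [v] by the square root of [rnorm (hdot v v) + e] moves it into the unit ball of
    [colnorm]; [e] prevents a division by 0. *)
Lemma mxcontr_of_norm X : (mxnorm X <= 1)%E -> mxcontr X.
Proof.
move=> X1 v; apply/ler_addgt0Pr => e e0.
set s := rnorm (hdot v v) + e.
have s0 : 0 < s by rewrite ltr_wpDl ?rnorm_ge0.
pose q := Num.sqrt s^-1.
have qq : q ^+ 2 = s^-1 by rewrite sqr_sqrtr // invr_ge0 ltW.
pose v' := map_mx (fun a : A => q%:C *: a) v.
have scale w : hdot (map_mx (fun a : A => q%:C *: a) w)
    (map_mx (fun a : A => q%:C *: a) w) = (s^-1)%:C *: hdot w w.
  rewrite /hdot scaler_sumr; apply: eq_bigr => i _.
  by rewrite !mxE starZr -cscalerAl -cscalerAr scalerA -rmorphM -expr2 qq.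
have Xv : X *m v' = map_mx (fun a : A => q%:C *: a) (X *m v).
  apply/matrixP => i j; rewrite !mxE scaler_sumr; apply: eq_bigr => k _.
  by rewrite mxE cscalerAr.
have v1 : colnorm v' <= 1.
  rewrite /colnorm -/(hdot v' v') scale rnormZr gtr0_norm ?invr_gt0 //.
  by rewrite -sqrtr1 ler_sqrt // mulrC ler_pdivrMr // mul1r lerDl ltW.
have : ((colnorm (X *m v'))%:E <= 1)%E.
  by apply: le_trans X1; apply: ereal_sup_ubound; exists v'.
rewrite lee_fin /colnorm -/(hdot (X *m v') (X *m v')) Xv scale rnormZr.
rewrite gtr0_norm ?invr_gt0 // -{1}sqrtr1 ler_sqrt //.
by rewrite mulrC ler_pdivrMr // mul1r.
Qed.

(** With [y = X^* w] one has [<y, y> = <w, X y>]. Cauchy-Schwarz and contractivity of [X] bound the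
    square of its norm by [rnorm (hdot w w) + e] times [rnorm (hdot y y)], and one factor
    cancels. *)
Lemma mxcontr_star X : mxcontr X -> mxcontr (mxstar X).
Proof.
move=> cX w; apply/ler_addgt0Pr => e e0.
set y := mxstar X *m w; set s := _ + e.
have s0 : 0 < s by rewrite ltr_wpDl ?rnorm_ge0.
have := @hdot_CauchySchwarz w (X *m y) s; rewrite ltrDl => /(_ e0).
rewrite -hdot_mulmx -/y => H.
have := le_trans H (ler_wpM2l (ltW s0) (cX y)).
have [->|y0] := eqVneq (rnorm (hdot y y)) 0; first by rewrite (ltW s0).
by rewrite expr2 ler_pM2r // lt_def y0 rnorm_ge0.
Qed.

Lemma mxcontrM X Y : mxcontr X -> mxcontr Y -> mxcontr (X *m Y).
Proof. by move=> cX cY v; rewrite -mulmxA; apply: le_trans (cX _) (cY _). Qed.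

(** [X] sends the [j]-th unit vector to its [j]-th column, and [rnorm_nneg_le] isolates one term of
    the resulting sum of positive elements. *)
Lemma mxcontr_entry X i j : mxcontr X -> rnorm (X i j) <= 1.
Proof.
move=> cX; have := cX (delta_mx j 0).
have -> : X *m delta_mx j 0 = col j X.
  apply/matrixP => k l; rewrite !mxE (bigD1 j) //= !mxE eqxx /= ord1 eqxx mulr1.
  by rewrite big1 ?addr0 // => m mj; rewrite !mxE (negPf mj) mulr0.
have -> : hdot (delta_mx j 0) (delta_mx j 0) = 1.
  rewrite /hdot (bigD1 j) //= !mxE !eqxx star1 mulr1.
  by rewrite big1 ?addr0 // => m mj; rewrite !mxE (negPf mj) mulr0.
move=> /le_trans /(_ (rnorm1_le1 A)).
rewrite /hdot (bigD1 i) //= !mxE => H.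
have : rnorm (X i j) ^+ 2 <= 1.
  rewrite -rnorm_starM; apply: le_trans H; apply: rnorm_nneg_le.
    exact: nneg_starM.
  by apply: nneg_sum => k _; apply: nneg_starM.
by rewrite expr_le1 // rnorm_ge0.
Qed.
End HilbertModule.

(** * Positive semidefinite kernels *)

(** Hermitian symmetry is derived: the values of the form at [(1, 0)], [(0, 1)], [(1, 1)] and
    [(1, i)] are real, so [a] and [d] are real and [b'] is the conjugate of [b]. *)
Lemma CauchySchwarz_complex (R : realType) (a b b' d : R[i]) :
  (forall u v : R[i],
     0 <= u * u^* * a + u * v^* * b + v * u^* * b' + v * v^* * d) ->
  `|b| ^+ 2 <= a * d.
Proof.
case: a b b' d => [a1 a2] [b1 b2] [c1 c2] [d1 d2] h.
have h10 := h 1%:C 0; have h01 := h 0 1%:C; have h11 := h 1%:C 1%:C.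
have h1i := h 1%:C 'i%C.
rewrite -add_Re2_Im2 lecE /=.
move: h10 h01 h11 h1i; rewrite !lecE /=.
move=> /andP[e1 p1] /andP[e2 p2] /andP[e3 p3] /andP[e4 p4].
have a20 : a2 = 0 by move/eqP: e1; lra.
have d20 : d2 = 0 by move/eqP: e2; lra.
have cb2 : c2 = - b2 by move/eqP: e3; lra.
have cb1 : c1 = b1 by move/eqP: e4; lra.
rewrite a20 d20 !(mul0r, mulr0, addr0, subr0) eqxx /=.
have a0 : 0 <= a1 by lra.
have d0 : 0 <= d1 by lra.
pose D := b1 ^+ 2 + b2 ^+ 2.
(* The form at [u = s], [v = - k b]. If [d1 = 0], the choice [s = D], [k = a1 + 1] forces [D = 0];
   otherwise [s = d1], [k = 1] gives the claim. *)
have q s k : 0 <= s ^+ 2 * a1 - 2 * s * k * D + k ^+ 2 * D * d1.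
  have := h s%:C ((- b1 * k) +i* (- b2 * k))%C; rewrite lecE /= => /andP[_].
  by rewrite cb1 cb2 a20 d20 /D; lra.
rewrite -/D.
have D0 : 0 <= D by rewrite addr_ge0 ?sqr_ge0.
have [d00|dn0] := eqVneq d1 0.
  have := q D (a1 + 1); rewrite d00; nra.
have dp : 0 < d1 by rewrite lt_def dn0.
have H := q d1 1.
by rewrite -subr_ge0 -(pmulr_rge0 _ dp); lra.
Qed.

(** If [x 0 = f + dl] with [dl > 0], the recursion makes [x n] at least [f + (n + 1) dl], against
    the bound [K]. Linear growth suffices, so no [2^n]-th root is taken. *)
Lemma le_of_sq_growth (R : realType) (x : nat -> R) (f K : R) : 0 <= f ->
  (forall n, 0 <= x n <= K) -> (forall n, x n ^+ 2 <= x n.+1 * f) -> x 0%N <= f.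
Proof.
move=> f0 xK xS; rewrite leNgt; apply/negP => lt.
have fp : 0 < f.
  rewrite lt_def f0 andbT; apply/eqP => f00.
  by have := xS 0%N; rewrite f00 mulr0 => x0; rewrite f00 in lt; nra.
set dl := x 0%N - f; have dl0 : 0 < dl by rewrite subr_gt0.
have grow n : f + n.+1%:R * dl <= x n.
  elim: n => [|n IH]; first by rewrite mul1r /dl; lra.
  have H := xS n; rewrite -(ler_pM2r fp) -natr1.
  have n1 : 1 <= n.+1%:R :> R by rewrite ler1n.
  have p : 0 <= (n.+1%:R - 1) * dl by rewrite mulr_ge0 ?subr_ge0 // ltW.
  have q : 0 <= n.+1%:R * dl by rewrite mulr_ge0 // ltW.
  have sq : (f + n.+1%:R * dl) ^+ 2 <= x n ^+ 2.
    by rewrite ler_sqr // nnegrE ?addr_ge0 // (le_trans _ IH) // addr_ge0.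
  have fp' : 0 <= f * ((n.+1%:R - 1) * dl) by rewrite mulr_ge0.
  have := sqr_ge0 (n.+1%:R * dl); lra.
have : K < (Num.truncn (K / dl)).+1%:R * dl.
  by rewrite -ltr_pdivrMr // truncnS_gt.
have := grow (Num.truncn (K / dl)); case/andP: (xK (Num.truncn (K / dl))).
lra.
Qed.

(* A list over [P] stands for the formal sum of its elements, on which [g] is
   a semi-inner product; no quotient or completion is taken. *)
Section Kernel.
Variables (R : realType) (A : cstarAlgType R) (I P : Type).
Variables (g : P -> P -> R[i]) (scl : R[i] -> P -> P) (act : I -> A -> P -> P).
Hypothesis gZl : forall z p q, g (scl z p) q = z * g p q.
Hypothesis gZr : forall z p q, g p (scl z q) = z^* * g p q.
Hypothesis g_ge0 : forall s : seq P, 0 <= \sum_(p <- s) \sum_(q <- s) g p q.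
Hypothesis act_linear : forall l z x y p q,
  g (act l (z *: x + y) p) q = z * g (act l x p) q + g (act l y p) q.
Hypothesis act_adj : forall l x y p q,
  g (act l x p) (act l y q) = g (act l (star y * x) p) q.
Hypothesis act1 : forall l p q, g (act l 1 p) q = g p q.

Section Families.
Variable t : nat.
Implicit Types (xi eta : 'I_t -> seq P) (X Y : 'M[A]_t) (l : I).

Definition kdot xi eta : R[i] :=
  \sum_(i < t) \sum_(p <- xi i) \sum_(q <- eta i) g p q.

Lemma kdot_ge0 xi : 0 <= kdot xi xi.
Proof. by apply: sumr_ge0 => i _; apply: g_ge0. Qed.

(** The combination [u xi + v eta] is the concatenation of the scaled lists; expanding its square
    gives the form in [CauchySchwarz_complex]. *)
Lemma kdot_CauchySchwarz xi eta :
  `|kdot xi eta| ^+ 2 <= kdot xi xi * kdot eta eta.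
Proof.
apply: (@CauchySchwarz_complex _ _ _ (kdot eta xi)) => u v.
have := kdot_ge0 (fun i => map (scl u) (xi i) ++ map (scl v) (eta i)).
have e z (zt : 'I_t -> seq P) y (et : 'I_t -> seq P) :
    \sum_(i < t) \sum_(p <- map (scl z) (zt i))
      \sum_(q <- map (scl y) (et i)) g p q
    = z * y^* * kdot zt et.
  rewrite /kdot mulr_sumr; apply: eq_bigr => i _.
  rewrite big_map mulr_sumr; apply: eq_bigr => p _.
  rewrite big_map mulr_sumr; apply: eq_bigr => q _.
  by rewrite gZl gZr mulrA.
rewrite {1}/kdot.
have -> : \sum_(i < t) \sum_(p <- map (scl u) (xi i) ++ map (scl v) (eta i))
     \sum_(q <- map (scl u) (xi i) ++ map (scl v) (eta i)) g p q =
  \sum_(i < t)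
   (\sum_(p <- map (scl u) (xi i)) \sum_(q <- map (scl u) (xi i)) g p q
   + \sum_(p <- map (scl u) (xi i)) \sum_(q <- map (scl v) (eta i)) g p q
   + (\sum_(p <- map (scl v) (eta i)) \sum_(q <- map (scl u) (xi i)) g p q
   + \sum_(p <- map (scl v) (eta i)) \sum_(q <- map (scl v) (eta i)) g p q)).
  apply: eq_bigr => i _; rewrite big_cat -!big_split /=.
  by congr (_ + _); apply: eq_bigr => p _; rewrite big_cat.
by rewrite !big_split /= !e addrA.
Qed.

(** The operator matrix with entries [pi_l (X i j)] applied to a [t]-tuple of formal sums, whose
    addition is concatenation. *)
Definition kop l X xi : 'I_t -> seq P :=
  fun i => flatten [seq [seq act l (X i j) p | p <- xi j] | j <- enum 'I_t].

Lemma sum_kop (V : nmodType) l X xi i (F : P -> V) :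
  \sum_(p <- kop l X xi i) F p =
  \sum_(j < t) \sum_(p <- xi j) F (act l (X i j) p).
Proof.
rewrite /kop big_flatten big_map big_enum /=.
by apply: eq_bigr => j _; rewrite big_map.
Qed.

Lemma act_sum l J (s : seq J) (F : J -> A) p q :
  g (act l (\sum_(j <- s) F j) p) q = \sum_(j <- s) g (act l (F j) p) q.
Proof.
have act0 : g (act l 0 p) q = 0.
  by have := act_linear l (-1) 0 0 p q; rewrite scaler0 addr0 mulN1r addNr.
apply: (big_morph (fun x => g (act l x p) q)) => // x y.
by have := act_linear l 1 x y p q; rewrite scale1r mul1r.
Qed.

Lemma kdot_kopM l X Y xi eta :
  kdot (kop l X xi) (kop l Y eta) = kdot (kop l (mxstar Y *m X) xi) eta.
Proof.
rewrite /kdot; under eq_bigr => i _ do rewrite sum_kop.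
under [RHS]eq_bigr => i _ do rewrite sum_kop.
rewrite exchange_big [RHS]exchange_big /=; apply: eq_bigr => j _.
rewrite exchange_big [RHS]exchange_big /=; apply: eq_bigr => p _.
under eq_bigr => i _ do rewrite sum_kop.
rewrite exchange_big /=; apply: eq_bigr => k _.
rewrite exchange_big /=; apply: eq_bigr => q _.
rewrite mxE act_sum; apply: eq_bigr => i _.
by rewrite act_adj !mxE.
Qed.

End Families.

(* [1 - x^* x / 4] is a square; the crude constant suffices since
   [kop_contr] needs only some bound that is uniform in [x]. *)
Lemma act_norm_le l x p : rnorm x <= 1 ->
  g (act l x p) (act l x p) <= 4%:C * g p p.
Proof.
move=> x1; pose b := (4^-1)%:C *: (star x * x).
have [||c [sc' bc _]] := @sqrt_exists R A b.
- by rewrite starZr starMr starK.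
- rewrite rnormZr rnorm_starM ger0_norm //.
  by have := rnorm_ge0 x; nra.
have := g_ge0 [:: act l c p]; rewrite !big_seq1 act_adj sc' -bc.
have -> : 1 - b = (- (4^-1)%:C) *: (star x * x) + 1 by rewrite scaleNr addrC.
rewrite act_linear act1 act_adj mulNr addrC subr_ge0.
rewrite -(ler_pM2l (_ : 0 < 4%:C)) ?ltcR // mulrA -rmorphM mulfV //.
by rewrite mul1r.
Qed.

(** The 1 comes from bounding a modulus by 1 plus its square, which avoids a square root. *)
Definition kbound p q : R[i] := 1 + 4%:C * (g p p * g q q).

Lemma act_bound l x p q : rnorm x <= 1 -> `|g (act l x p) q| <= kbound p q.
Proof.
move=> x1; set y := g _ q.
have gpp s : 0 <= g s s by have := g_ge0 [:: s]; rewrite !big_seq1.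
have : `|y| ^+ 2 <= 4%:C * (g p p * g q q).
  have := @kdot_CauchySchwarz 1 (fun=> [:: act l x p]) (fun=> [:: q]).
  rewrite /kdot !big_ord1 !big_seq1 => /le_trans; apply.
  by rewrite mulrA ler_wpM2r // act_norm_le.
rewrite /kbound -(lerD2l 1); apply: le_trans.
have -> : `|y| = (complex.Re `|y|)%:C by rewrite RRe_real // normr_real.
move: (complex.Re _) => r; rewrite -rmorphXn -(rmorph1 (real_complex R)).
rewrite -rmorphD lecR; have := sqr_ge0 (r - 1); have := sqr_ge0 r; lra.
Qed.

Section Words.
Variable t : nat.
Implicit Types (xi eta : 'I_t -> seq P) (X Y : 'M[A]_t) (l : I).

Lemma kop_contr l X xi : mxcontr X ->
  kdot (kop l X xi) (kop l X xi) <= kdot xi xi.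
Proof.
move=> cX.
(* [Z n] is [(X^* X)^(2^n)], a self-adjoint contraction, so its entries have norm at most 1 and the
   bound [K] below is uniform in [n]. *)
pose Z := fix F n := if n is m.+1 then F m *m F m else mxstar X *m X.
have sZ n : mxstar (Z n) = Z n.
  by elim: n => [|n IH] /=; rewrite mxstarM ?mxstarK // IH.
have cZ n : mxcontr (Z n).
  elim: n => [|n IH] /=; apply: mxcontrM => //; exact: mxcontr_star.
pose K := \sum_(i < t) \sum_(j < t) \sum_(p <- xi j)
  \sum_(q <- xi i) kbound p q.
pose F n := kdot (kop l (Z n) xi) xi.
have F_ge0 n : 0 <= F n.
  case: n => [|n]; first by rewrite /F /= -kdot_kopM kdot_ge0.
  by rewrite /F /= -{1}(sZ n) -kdot_kopM kdot_ge0.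
have FK n : F n <= K.
  rewrite -(ger0_norm (F_ge0 n)) /F /kdot.
  apply: le_trans (ler_norm_sum _ _ _) (ler_sum _ _) => i _.
  rewrite sum_kop; apply: le_trans (ler_norm_sum _ _ _) (ler_sum _ _) => j _.
  apply: le_trans (ler_norm_sum _ _ _) (ler_sum _ _) => p _.
  apply: le_trans (ler_norm_sum _ _ _) (ler_sum _ _) => q _.
  by apply/act_bound/mxcontr_entry/cZ.
(* Cauchy-Schwarz for [pi_l (Z n) xi] and [xi], since [Z n.+1] is the square of [Z n]. *)
have FS n : F n ^+ 2 <= F n.+1 * kdot xi xi.
  have := kdot_CauchySchwarz (kop l (Z n) xi) xi.
  by rewrite kdot_kopM sZ -/(F n) ger0_norm.
have ReE (z : R[i]) : 0 <= z -> z = (complex.Re z)%:C.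
  by move=> z0; rewrite RRe_real // ger0_real.
rewrite kdot_kopM -/(F 0%N) (ReE _ (F_ge0 0%N)) (ReE _ (kdot_ge0 xi)) lecR.
have K0 : 0 <= K := le_trans (F_ge0 0%N) (FK 0%N).
apply: (@le_of_sq_growth _ (fun n => complex.Re (F n)) _ (complex.Re K)).
- by rewrite -ler0c -ReE // kdot_ge0.
- by move=> n; rewrite -ler0c -lecR -!ReE // F_ge0 FK.
- by move=> n; rewrite -lecR rmorphXn rmorphM /= -!ReE ?kdot_ge0.
Qed.

(** The first letter of [w] is the outermost factor. *)
Definition kword (w : seq (I * 'M[A]_t)) xi : 'I_t -> seq P :=
  foldr (fun lX => kop lX.1 lX.2) xi w.

Lemma kword_contr w xi : (forall lX, List.In lX w -> mxcontr lX.2) ->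
  kdot (kword w xi) (kword w xi) <= kdot xi xi.
Proof.
elim: w => [|lX w IH] h //=.
apply: le_trans (kop_contr _ _ _) (IH _); first by apply: h; left.
by move=> lY wY; apply: h; right.
Qed.

(** The summand of [kword] along the matrix indices [r 0, r 1, ...]. With paths indexed by [nat],
    removing the first letter is a shift. *)
Fixpoint kpath (v : 'I_t -> P) (w : seq (I * 'M[A]_t)) (r : nat -> 'I_t) : P :=
  if w is lX :: w' then
    act lX.1 (lX.2 (r 0%N) (r 1%N)) (kpath v w' (fun n => r n.+1))
  else v (r 0%N).

Lemma eq_kpath v w (r s : nat -> 'I_t) :
  (forall n, (n <= size w)%N -> r n = s n) -> kpath v w r = kpath v w s.
Proof.
elim: w r s => [|lX w IH] r s rs /=; first by rewrite rs.
by rewrite !rs //; congr act; apply: IH => n nw; apply: rs.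
Qed.

Lemma sum_kword (V : nmodType) v w i (F : P -> V) :
  \sum_(p <- kword w (fun j => [:: v j]) i) F p =
  \sum_(r : {ffun 'I_(size w).+1 -> 'I_t} | r ord0 == i)
    F (kpath v w (fun n => r (inord n))).
Proof.
elim: w i F => [|lX w IH] i F.
  rewrite /= big_seq1 (big_pred1 [ffun=> i]) ?ffunE // => r /=.
  apply/eqP/eqP => [<-|->]; last by rewrite ffunE.
  by apply/ffunP => k; rewrite ffunE ord1.
rewrite [kword _ _]/= sum_kop.
under eq_bigr => j _ do rewrite (IH j (fun p => F (act lX.1 (lX.2 i j) p))).
(* [h] prepends the vertex [i] to a path and [h'] removes the first vertex. *)
pose h (r : {ffun 'I_(size w).+1 -> 'I_t}) : {ffun 'I_(size w).+2 -> 'I_t} :=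
  [ffun k => if unlift ord0 k is Some k' then r k' else i].
pose h' (r : {ffun 'I_(size w).+2 -> 'I_t}) : {ffun 'I_(size w).+1 -> 'I_t} :=
  [ffun k => r (lift ord0 k)].
rewrite [RHS](reindex_onto h h') /=; last first.
  move=> r /eqP ri; apply/ffunP => k; rewrite ffunE.
  by case: unliftP => [k' ->|->]; rewrite ?ffunE.
have hP r : (h r ord0 == i) && (h' (h r) == r).
  rewrite ffunE unlift_none eqxx /=; apply/eqP/ffunP => k.
  by rewrite !ffunE liftK.
rewrite [RHS](eq_bigl xpredT) //.
rewrite [RHS](partition_big (fun r : {ffun _} => r ord0) xpredT) //=.
apply: eq_bigr => j _; apply: eq_bigr => r /eqP rj.
have hS n : (n <= size w)%N -> h r (inord n.+1) = r (inord n).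
  move=> nw; have -> : inord n.+1 = lift ord0 (inord n : 'I_(size w).+1).
    by apply: val_inj; rewrite /= inordK ?inordK.
  by rewrite ffunE liftK.
have h0 : h r (inord 0) = i.
  have -> : inord 0 = ord0 :> 'I_(size w).+2.
    by apply: val_inj; rewrite /= inordK.
  by rewrite ffunE unlift_none.
rewrite h0 hS //; congr (F (act _ (_ _ _) _)).
  by rewrite -rj; congr (r _); apply: val_inj; rewrite /= inordK.
by apply: eq_kpath => n nw; rewrite hS.
Qed.
End Words.
End Kernel.

(** * The kernel of an invariant completely positive map *)

Section Inner.
Variables (R : realType) (H : hilbertType R).
Implicit Types (x y w : H) (z : R[i]).

Lemma innerDl x y w : inner (x + y) w = inner x w + inner y w.
Proof. exact: linearDl. Qed.

Lemma innerZl z x w : inner (z *: x) w = z * inner x w.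
Proof. exact: linearZl_LR. Qed.

Lemma inner0l w : inner 0 w = 0.
Proof. exact: linear0l. Qed.

Lemma innerZr z x w : inner x (z *: w) = z^* * inner x w.
Proof. exact: linearZr_LR. Qed.

Lemma inner_suml I (s : seq I) (Q : pred I) (F : I -> H) w :
  inner (\sum_(i <- s | Q i) F i) w = \sum_(i <- s | Q i) inner (F i) w.
Proof.
by apply: (big_morph (fun x => inner x w)) => [x y|]; rewrite ?innerDl ?inner0l.
Qed.

Lemma bounded_operator_linear (T : bounded_operator H) : linear T.
Proof. by have /asboolP[] := bounded_operatorP T. Qed.

Lemma bounded_operatorZ (T : bounded_operator H) z x : T (z *: x) = z *: T x.
Proof.
have T0 : T 0 = 0.
  have := bounded_operator_linear T (-1) 0 0.
  by rewrite scaler0 addr0 scaleN1r addNr.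
by have := bounded_operator_linear T z x 0; rewrite T0 !addr0.
Qed.

Lemma bounded_operator_sum I (s : seq I) (Q : pred I)
    (F : I -> bounded_operator H) x :
  (\sum_(i <- s | Q i) F i) x = \sum_(i <- s | Q i) F i x.
Proof. by apply: (big_morph (fun T : bounded_operator H => T x)). Qed.
End Inner.

Section Dilation.
Variables (R : realType) (A : cstarAlgType R) (H : hilbertType R) (k : nat).
Variable phi : ('I_k -> A) -> bounded_operator H.
Hypotheses (phi_lin : multilinear phi) (phi_inv : invariant_map phi).
Hypothesis phi_cp : completely_positive phi.

(* The map [Psi] is [phi \o right_half]: only the arguments right of the middle
   (included, for odd k) are used. *)
Definition right_half (b : 'I_k -> A) : 'I_k -> A :=
  fun i => if (i < k./2)%N then 1 else b i.

Definition fold_half (a : 'I_k -> A) : 'I_k -> A :=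
  fun i => if (rev_ord i < k./2)%N then a (rev_ord i) * a i else a i.

(** Invariance is applied to the tuple with 1 in the left positions and to [c = a]: the left
    arguments reappear as factors at the mirror positions. *)
Lemma phi_fold a : phi a = phi (right_half (fold_half a)).
Proof.
have := phi_inv (right_half a) a; rewrite /right_half.
have -> : (fun i : 'I_k => if (i < k./2)%N
    then (if (i < k./2)%N then 1 else a i) * a i
    else if (i < k./2)%N then 1 else a i) = a.
  by apply/funext => i; case: (ltnP i k./2) => _ //; rewrite mul1r.
move=> ->; congr phi; apply/funext => i; rewrite /fold_half /=.
by case: (ltnP i k./2) => // ik; rewrite ifF //; lia.
Qed.

Lemma phi_arg0 (a : 'I_k -> A) i : a i = 0 -> phi a = 0.
Proof.
move=> ai; have := phi_lin a i (-1) 0 0.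
have -> : update a i (-1 *: 0 + 0) = a.
  by apply/funext => j; rewrite /update scaler0 addr0; case: eqP => // ->.
have -> : update a i 0 = a.
  by apply/funext => j; rewrite /update; case: eqP => // ->.
by rewrite scaleN1r addNr.
Qed.

Definition gvec := (('I_k -> A) * H)%type.

Definition gker (p q : gvec) : R[i] :=
  inner (phi (right_half (fun l => star (q.1 l) * p.1 l)) p.2) q.2.

Definition gscale (z : R[i]) (p : gvec) : gvec := (p.1, z *: p.2).

(** The mirror positions [l] and [rev_ord l] share one coordinate, because [fold_half] multiplies
    their arguments together. *)
Definition fold_index (l : 'I_k) : 'I_k :=
  if (l < k./2)%N then rev_ord l else l.

Definition gact (l : 'I_k) (x : A) (p : gvec) : gvec :=
  (update p.1 (fold_index l) (x * p.1 (fold_index l)), p.2).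

Lemma gkerZl z p q : gker (gscale z p) q = z * gker p q.
Proof. by rewrite /gker /= bounded_operatorZ innerZl. Qed.

Lemma gkerZr z p q : gker p (gscale z q) = z^* * gker p q.
Proof. by rewrite /gker /= innerZr. Qed.

Lemma fold_index_ge l : (k./2 <= fold_index l)%N.
Proof. by rewrite /fold_index; case: ltnP => //= lk; lia. Qed.

Lemma gact_linear l z x y p q :
  gker (gact l (z *: x + y) p) q =
  z * gker (gact l x p) q + gker (gact l y p) q.
Proof.
set m := fold_index l.
have e w : right_half (fun j => star (q.1 j) * (gact l w p).1 j) =
    update (right_half (fun j => star (q.1 j) * p.1 j)) m
      (star (q.1 m) * (w * p.1 m)).
  apply/funext => j; rewrite /right_half /update /gact /= /update -/m.
  by case: eqP => [->|//]; rewrite ltnNge fold_index_ge.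
rewrite /gker !e mulrDl -cscalerAl mulrDr -cscalerAr phi_lin /=.
by rewrite -innerZl -innerDl.
Qed.

Lemma gact_adj l x y p q :
  gker (gact l x p) (gact l y q) = gker (gact l (star y * x) p) q.
Proof.
rewrite /gker /=; congr (inner (phi _ _) _); apply/funext => j.
rewrite /right_half /update; case: ifP => // _; case: eqP => // ->.
by rewrite starMr !mulrA.
Qed.

Lemma gact1 l p q : gker (gact l 1 p) q = gker p q.
Proof.
rewrite /gker /=; congr (inner (phi _ _) _); apply/funext => j.
rewrite /right_half /update; case: ifP => // _.
by case: eqP => // ->; rewrite mul1r.
Qed.

(* [X_l] is built from diagonal matrices, except for a row (or its adjoint) at
   the middle, so that a single path [r_0, ..., r_k] contributes to each entry
   of the amplification. *)
Lemma gker_ge0 (hk : (0 < k)%N) (s : seq gvec) :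
  0 <= \sum_(p <- s) \sum_(q <- s) gker p q.
Proof.
(* Complete positivity concerns matrices of positive size, so the empty list is treated apart; [p0]
   also serves as the default of [nth]. *)
case: s => [|p0 s']; first by rewrite big_nil.
set s := p0 :: s'; set n := (size s').+1.
pose b (r : 'I_n) := (nth p0 s r).1; pose h (r : 'I_n) := (nth p0 s r).2.
(* At position [k./2] only row [ord0] is nonzero. For odd [k] this makes the middle matrix [D^* D],
   with entries [b_u^* b_v]; for even [k] the row and the adjoint column before it meet at index
   [ord0]. *)
pose D (i : 'I_k) : 'M[A]_n := \matrix_(r, r')
  (if (if i == k./2 :> nat then r == ord0 else r == r') then b r' i else 0).
pose X (i : 'I_k) : 'M[A]_n := if (i < k./2)%N then mxstar (D (rev_ord i))
  else if odd k && (i == k./2 :> nat) then mxstar (D i) *m D i else D i.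
have Xstar l : X l = mxstar (X (rev_ord l)).
  rewrite /X rev_ordK /=; case: (ltnP l k./2) => lk.
    by rewrite ifF ?ifF //; [apply/negP => /andP[]; lia | lia].
  case: ifP => [/andP[ok /eqP lE]|nmid].
    have -> : rev_ord l = l by apply: val_inj => /=; lia.
    have -> : (k - l.+1 = k./2)%N by lia.
    by rewrite ltnn ok eqxx mxstarM mxstarK.
  have lk2 : (k - l.+1 < k./2)%N.
    have lo := ltn_ord l; move/negbT: nmid; rewrite negb_and.
    by move=> /orP[|/eqP]; clear -lk lo; lia.
  by rewrite lk2 mxstarK.
have Xpos : odd k -> forall l : 'I_k, l = k./2 :> nat -> mxpos (X l).
  by move=> ok l lk; rewrite /X lk ltnn ok eqxx; exists (D l).
have := phi_cp (ltn0Sn (size s')) Xstar Xpos h.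
(* The contributing path: [i] left of the middle, [j] right of it. For even [k] the middle vertex is
   [ord0]; for odd [k], [uphalf k = k./2 + 1] and there is no such vertex. *)
pose path (i j : 'I_n) : {ffun 'I_k.+1 -> 'I_n} :=
  [ffun l : 'I_k.+1 =>
    if (l < uphalf k)%N then i else if (l > k./2)%N then j else ord0].
have pathE i j (l : 'I_k.+1) : path i j l =
    if (l < uphalf k)%N then i else if (l > k./2)%N then j else ord0.
  by rewrite ffunE.
have D0 i r r' : D i r r' != 0 ->
    if i == k./2 :> nat then r = ord0 else r = r'.
  rewrite mxE; case: (nat_of_ord i == _); [case: (r =P ord0) | case: (r =P r')];
    by rewrite ?eqxx.
have ampE i j : amplification phi X i j =
    phi (right_half (fun l => star (b i l) * b j l)).
  have XL (l : 'I_k) u v : (l < k./2)%N -> X l u v = star (D (rev_ord l) v u).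
    by move=> lk; rewrite /X lk !mxE.
  have XR (l : 'I_k) :
      (k./2 <= l)%N -> ~~ (odd k && (l == k./2 :> nat)) -> X l = D l.
    by move=> lk nm; rewrite /X ltnNge lk (negPf nm).
  have XM (l : 'I_k) u v :
      odd k -> l = k./2 :> nat -> X l u v = star (b u l) * b v l.
    move=> ok lE; rewrite /X lE ltnn ok eqxx !mxE (bigD1 ord0) //=.
    rewrite !mxE lE !eqxx.
    by rewrite big1 ?addr0 // => m m0; rewrite !mxE lE !eqxx (negPf m0) mulr0.
  rewrite mxE (bigD1 (path i j)) /=; last first.
    have [h1 h2 h3] :
        [/\ (0 < uphalf k)%N, (k < uphalf k)%N = false & (k./2 < k)%N].
      by split; lia.
    by rewrite !pathE /= h1 h2 h3 !eqxx.
  rewrite big1 ?addr0 => [|r /andP[/andP[/eqP ri /eqP rj] nr]].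
    rewrite phi_fold; congr phi; apply/funext => l; rewrite /right_half.
    case: ltnP => // lk; rewrite /fold_half.
    have [/andP[ok /eqP lE]|nm] := boolP (odd k && (l == k./2 :> nat)).
      rewrite ifF; last by rewrite /=; lia.
      rewrite XM // !pathE lift0 /= ifT; last lia.
      by rewrite ifF ?ifT //; lia.
    have lo := ltn_ord l.
    have lk2 : (rev_ord l < k./2)%N.
      by move: nm => /=; rewrite negb_and => /orP[|/eqP]; clear -lk lo; lia.
    rewrite lk2 XL // rev_ordK XR // !mxE !pathE !lift0 /=.
    have [h1 h2 h3 h4] : [/\ (k - l.+1 < uphalf k)%N, (l < uphalf k)%N = false,
        (l.+1 < uphalf k)%N = false & (k./2 < l.+1)%N].
      by split; move: nm; rewrite negb_and => /orP[|/eqP]; clear -lk lo; lia.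
    rewrite h1 h2 h3 h4; case: eqP => [lE|lE].
      have ek : ~~ odd k by move: nm; rewrite lE eqxx andbT.
      have -> : ((k - l.+1).+1 < uphalf k)%N = false by clear -lk lo lE ek; lia.
      have -> : (k./2 < (k - l.+1).+1)%N = false by clear -lk lo lE ek; lia.
      have -> : (k./2 < l)%N = false by clear -lk lo lE ek; lia.
      by rewrite !eqxx.
    have -> : ((k - l.+1).+1 < uphalf k)%N by clear -lk lo lE; lia.
    have -> : (k./2 < l)%N by clear -lk lo lE; lia.
    by rewrite !eqxx.
  (* A path meeting a zero entry contributes 0. Otherwise the nonzero entries determine every vertex
     and the path is [path i j]. *)
  have [[l l0]|nl] := pselect
      (exists l, X l (r (widen_ord (leqnSn k) l)) (r (lift ord0 l)) = 0).
    exact: phi_arg0 l0.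
  case/eqP: nr; apply/ffunP.
  pose rn n := r (inord n).
  have rnE l : r l = rn l by rewrite /rn inord_val.
  have Xn0 (l : 'I_k) : X l (rn l) (rn l.+1) != 0.
    apply/eqP => X0; apply: nl; exists l; rewrite !rnE lift0 /=.
    exact: X0.
  have stepL m : (m.+1 < uphalf k)%N -> rn m.+1 = rn m.
    move=> mk; have mk' : (m < k)%N by lia.
    have := Xn0 (Ordinal mk'); rewrite XL /=; last lia.
    have [->|/D0] := eqVneq (D (rev_ord (Ordinal mk')) (rn m.+1) (rn m)) 0.
      by rewrite star0 eqxx.
    by rewrite /= ifF //; lia.
  have stepR m : (k./2 < m < k)%N -> rn m = rn m.+1.
    move=> /andP[mk mk']; have := Xn0 (Ordinal mk'); rewrite XR /=; try lia.
    by move=> /D0 /=; rewrite ifF //; lia.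
  have left m : (m < uphalf k)%N -> rn m = i.
    elim: m => [|m IH] mk.
      by rewrite -ri rnE.
    by rewrite stepL // IH // ltnW.
  have right d : (d < uphalf k)%N -> rn (k - d)%N = j.
    elim: d => [|d IH] dk.
      by rewrite subn0 -rj rnE.
    rewrite stepR; last lia.
    have -> : ((k - d.+1).+1 = k - d)%N by lia.
    by rewrite IH // ltnW.
  move=> l; have ll := ltn_ord l; rewrite rnE pathE; case: ltnP => [/left //|lk].
  case: ltnP => lk2.
    have -> : (l = k - (k - l) :> nat)%N by lia.
    by apply: right; lia.
  (* The remaining vertex is the middle one of even [k], where a nonzero entry of the row matrix
     forces [ord0]. *)
  have ek : ~~ odd k by lia.
  have lk' : (l < k)%N by lia.
  have := Xn0 (Ordinal lk'); rewrite XR /=; try lia.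
  by move=> /D0 /=; rewrite ifT //; lia.
rewrite /tupinner /opmx_app.
under eq_bigr => i _.
  rewrite inner_suml.
  under eq_bigr => j _ do rewrite ampE.
  over.
rewrite exchange_big /=.
rewrite (big_nth p0) big_mkord.
by under [X in _ -> 0 <= X]eq_bigr => i _ do rewrite (big_nth p0) big_mkord.
Qed.

End Dilation.

(** * Operator norms and the Hilbert space of tuples *)

Section Norms.
Variables (R : realType) (H : hilbertType R).
Implicit Types (T : bounded_operator H) (x y : H).

Lemma inner_rnorm x : inner x x = (rnorm x ^+ 2)%:C.
Proof. by rewrite inner_norm normr_rnorm rmorphXn. Qed.

Lemma inner_CauchySchwarz x y : `|inner x y| ^+ 2 <= inner x x * inner y y.
Proof.
apply: (@CauchySchwarz_complex _ _ _ (inner y x)) => u v.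
have : 0 <= inner (u *: x + v *: y) (u *: x + v *: y).
  by rewrite inner_norm exprn_ge0.
by rewrite innerDl !innerZl !linearDr /= !innerZr !mulrA addrA.
Qed.

(** Boundedness makes the extended-real supremum finite, so that later estimates can use a real
    constant. *)
Lemma opnorm_bound T : exists nu : R,
  [/\ 0 <= nu, opnorm T = nu%:E & forall x, rnorm (T x) <= nu * rnorm x].
Proof.
have /asboolP[_ [[M N] TM]] := bounded_operatorP T.
have ball0 : [set x : H | rnorm x <= 1] 0 by rewrite /= rnorm0.
have nu0 : (0 <= opnorm T)%E.
  apply: (@le_trans _ _ (rnorm (T 0))%:E); first by rewrite lee_fin rnorm_ge0.
  by apply: ereal_sup_ubound; exists 0.
have nuM : (opnorm T <= `|M|%:E)%E.
  apply: ge_ereal_sup => _ [x /= x1 <-]; rewrite lee_fin.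
  have := TM x; rewrite !normr_rnorm lecE /= => /andP[_].
  rewrite mulr0 subr0 => /le_trans; apply.
  apply: le_trans (ler_norm _) _; rewrite normrM (ger0_norm (rnorm_ge0 x)).
  by rewrite ler_piMr.
have fin : opnorm T \is a fin_num.
  by rewrite ge0_fin_numE // (le_lt_trans nuM) // ltry.
exists (fine (opnorm T)); rewrite fineK //; split=> //; first exact: fine_ge0.
move=> x; have [->|x0] := eqVneq x 0.
  have -> : T 0 = 0 by rewrite -(scale0r (0 : H)) bounded_operatorZ !scale0r.
  by rewrite rnorm0 mulr0.
have xp : 0 < rnorm x.
  by rewrite lt_def rnorm_ge0 andbT; apply: contra_neq x0; apply: rnorm_eq0.
rewrite -ler_pdivrMr // -lee_fin fineK //; apply: ereal_sup_ubound.
exists ((rnorm x)^-1%:C *: x) => /=.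
  by rewrite rnormZr gtr0_norm ?invr_gt0 // mulVf ?gt_eqF.
by rewrite bounded_operatorZ rnormZr gtr0_norm ?invr_gt0 // mulrC.
Qed.

Lemma tupinner_tupnorm t (x : 'I_t -> H) : tupinner x x = (tupnorm x ^+ 2)%:C.
Proof.
rewrite /tupnorm sqr_sqrtr; last by apply: sumr_ge0 => i _; apply: sqr_ge0.
by rewrite rmorph_sum; apply: eq_bigr => i _; apply: inner_rnorm.
Qed.
End Norms.

(** * Words in the representations along paths of matrix indices *)

Section Paths.
Variables (R : realType) (A : cstarAlgType R) (H : hilbertType R) (k t : nat).
Variable X : 'I_k -> 'M[A]_t.
Implicit Types (v : 'I_t -> gvec A H k) (r : nat -> 'I_t).

Definition word (s : seq 'I_k) := [seq (i, X i) | i <- s].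

Lemma kpath_snd v s r :
  (kpath (@gact _ A H k) v (word s) r).2 = (v (r (size s))).2.
Proof. by elim: s r => [|l s IH] r //=; rewrite IH. Qed.

Lemma kpath_fst l0 v s r m : (kpath (@gact _ A H k) v (word s) r).1 m =
  \prod_(n <- iota 0 (size s) | fold_index (nth l0 s n) == m)
     X (nth l0 s n) (r n) (r n.+1) * (v (r (size s))).1 m.
Proof.
elim: s r => [|l s IH] r /=; first by rewrite big_nil mul1r.
rewrite big_cons /= -[1%N]addn0 iotaDl big_map /update /=.
by rewrite eq_sym; case: eqP => [->|_]; rewrite IH // mulrA.
Qed.

(** The letters acting on coordinate [m] are [rev_ord m] and [m], in this order, or [m] alone if it
    is the middle of an odd [k]; their product is the one formed by [fold_half]. *)
Lemma kpath_enum v r (m : 'I_k) :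
  (forall j, (v j).1 = fun=> 1) -> (k./2 <= m)%N ->
  (kpath (@gact _ A H k) v (word (enum 'I_k)) r).1 m =
  fold_half (fun l : 'I_k => X l (r l) (r l.+1)) m.
Proof.
move=> v1 km; rewrite (kpath_fst m) v1 mulr1 size_enum_ord -big_filter.
have mk := ltn_ord m.
(* Both lists are strictly increasing, so it suffices to compare their elements. *)
have -> : [seq n <- iota 0 k | fold_index (nth m (enum 'I_k) n) == m] =
    if (rev_ord m < k./2)%N then [:: rev_ord m : nat; m : nat]
    else [:: m : nat].
  apply: (irr_sorted_eq ltn_trans ltnn).
  - by apply: (sorted_filter ltn_trans); apply: iota_ltn_sorted.
  - by case: ifP => //= h; rewrite andbT; clear -h km mk; lia.
  move=> n; rewrite mem_filter mem_iota add0n /=.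
  have [nk|nk] := ltnP n k; last first.
    by rewrite andbF; case: ifP => h; rewrite !inE /=; apply/esym/negbTE; lia.
  rewrite andbT /fold_index -val_eqE.
  case: ifP; rewrite /= nth_enum_ord // => h; case: ifP => h'; rewrite !inE;
    apply/idP/idP; clear -h h' nk km mk; lia.
rewrite /fold_half; case: ifP => h; rewrite ?big_cons big_nil mulr1.
  by rewrite !nth_ord_enum.
by rewrite nth_ord_enum.
Qed.
End Paths.

(** * Dilation of the amplifications and the norm estimate *)

Section Main.
Variables (R : realType) (A : cstarAlgType R) (H : hilbertType R) (k : nat).
Variable phi : ('I_k -> A) -> bounded_operator H.
Hypotheses (hk : (0 < k)%N) (phi_lin : multilinear phi).
Hypotheses (phi_inv : invariant_map phi) (phi_cp : completely_positive phi).

(** The dilation embedding of [H^t]: each [x_j] is paired with the tuple [(1, ..., 1)]. *)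
Definition gstart t (x : 'I_t -> H) (j : 'I_t) : gvec A H k := (fun=> 1, x j).

(** Both sides are sums over paths, on the left by the definition of [amplification], on the right
    by [sum_kword]. [phi_fold] and [kpath_enum] match the terms. *)
Lemma amplification_dilation t (X : 'I_k -> 'M[A]_t) (x y : 'I_t -> H) :
  tupinner (opmx_app (amplification phi X) x) y =
  kdot (gker phi)
    (kword (@gact _ A H k) (word X (enum 'I_k)) (fun j => [:: gstart x j]))
    (fun i => [:: gstart y i]).
Proof.
rewrite /kdot /tupinner; apply: eq_bigr => i _.
rewrite sum_kword size_map size_enum_ord /opmx_app inner_suml.
rewrite [RHS](partition_big (fun r : {ffun _} => r ord_max) xpredT) //=.
apply: eq_bigr => j _; rewrite mxE bounded_operator_sum inner_suml.
apply: eq_bigr => r /andP[/eqP ri /eqP rj].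
rewrite big_seq1 /gker kpath_snd size_enum_ord /=.
have -> : r (inord k) = j.
  by rewrite -rj; congr (r _); apply: val_inj; rewrite /= inordK.
rewrite phi_fold //; congr (inner (bounded_operator_fun (phi _) _) _).
apply/funext => l; rewrite /right_half; case: ltnP => // lk.
rewrite star1 mul1r kpath_enum //; congr (fold_half _ l).
apply/funext => m; congr (X m (r _) (r _)); apply: val_inj.
  by rewrite /= inordK // ltnW // ltnS.
by rewrite /= inordK // ltnS.
Qed.

(** The kernel at [(1, x_i)] is [<phi(1, ..., 1) x_i, x_i>], which is nonnegative and bounded by
    Cauchy-Schwarz in [H]. *)
Lemma kdot_gstart t (x : 'I_t -> H) (nu : R) : 0 <= nu ->
  (forall h, rnorm (phi (fun=> 1) h) <= nu * rnorm h) ->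
  kdot (gker phi) (fun i => [:: gstart x i]) (fun i => [:: gstart x i])
    <= (nu * tupnorm x ^+ 2)%:C.
Proof.
move=> nu0 phinu; rewrite /tupnorm sqr_sqrtr; last first.
  by apply: sumr_ge0 => i _; apply: sqr_ge0.
rewrite mulr_sumr rmorph_sum; apply: ler_sum => i _; rewrite !big_seq1 /gker /=.
have -> : right_half (fun _ : 'I_k => star 1 * 1) = fun=> 1 :> A.
  by apply/funext => l; rewrite /right_half star1 mulr1 if_same.
set h := x i; set T := phi _ in phinu *.
have z0 : 0 <= inner (T h) h.
  have := gker_ge0 phi_lin phi_inv phi_cp hk [:: gstart x i].
  rewrite !big_seq1 /gker /=.
  have -> // : right_half (fun _ : 'I_k => star 1 * 1) = fun=> 1 :> A.
  by apply/funext => l; rewrite /right_half star1 mulr1 if_same.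
have := inner_CauchySchwarz (T h) h; rewrite (ger0_norm z0) !inner_rnorm.
rewrite -(RRe_real (ger0_real z0)) -rmorphXn -rmorphM !lecR => zh.
have hh := rnorm_ge0 h; have := phinu h; have := rnorm_ge0 (T h) => T0 Th.
have rh : 0 <= nu * rnorm h ^+ 2 by rewrite mulr_ge0 ?sqr_ge0.
rewrite -ler_sqr ?nnegrE //; last by rewrite -ler0c RRe_real // ger0_real.
apply: le_trans zh _; rewrite -!exprMn ler_sqr ?nnegrE ?mulr_ge0 //.
by rewrite expr2 mulrA ler_wpM2r.
Qed.

(** With [y] the image of [x], the dilation writes the square of [tupnorm y] as a [kdot] of a
    contractive word on the embedded [x] with the embedded [y]. Cauchy-Schwarz bounds its fourth
    power by [nu] times [nu] times its square. *)
Lemma tupnorm_amplification_le t (X : 'I_k -> 'M[A]_t) (x : 'I_t -> H) (nu : R) :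
  (forall l, (mxnorm (X l) <= 1)%E) -> 0 <= nu ->
  (forall h, rnorm (phi (fun=> 1) h) <= nu * rnorm h) -> tupnorm x <= 1 ->
  tupnorm (opmx_app (amplification phi X) x) <= nu.
Proof.
move=> X1 nu0 phinu x1; set y := opmx_app _ x.
have kge := gker_ge0 phi_lin phi_inv phi_cp hk.
have := kdot_CauchySchwarz (@gkerZl _ _ _ _ phi) (@gkerZr _ _ _ _ phi) kge
  (kword (@gact _ A H k) (word X (enum 'I_k)) (fun j => [:: gstart x j]))
  (fun i => [:: gstart y i]).
rewrite -amplification_dilation -/y tupinner_tupnorm.
have y0 : 0 <= tupnorm y by apply: sqrtr_ge0.
have x0 : 0 <= tupnorm x by apply: sqrtr_ge0.
rewrite ger0_norm ?ler0c ?sqr_ge0 // => CS.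
have : (tupnorm y ^+ 2)%:C ^+ 2 <= (nu * (nu * tupnorm y ^+ 2))%:C.
  apply: le_trans CS _; rewrite rmorphM; apply: ler_pM.
  - exact: kdot_ge0.
  - exact: kdot_ge0.
  - apply: le_trans (kword_contr (@gkerZl _ _ _ _ phi) (@gkerZr _ _ _ _ phi) kge
      (gact_linear phi_lin) (gact_adj phi) (gact1 phi) _ _) _.
      move=> lX /(@List.in_map_iff _ _ (fun i => (i, X i))) [l [<- _]].
      by apply: mxcontr_of_norm; apply: X1.
    apply: le_trans (kdot_gstart x nu0 phinu) _; rewrite lecR.
    by rewrite ler_piMr // exprn_ile1.
  - exact: kdot_gstart.
rewrite -rmorphXn lecR => le.
have [->//|yn0] := eqVneq (tupnorm y) 0.
have yp : 0 < tupnorm y ^+ 2 by rewrite exprn_gt0 // lt_def yn0.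
move: le; rewrite mulrA [leLHS]expr2 ler_pM2r // -expr2.
by rewrite ler_sqr ?nnegrE.
Qed.

(** The supremum is tested at [t = 1] with every matrix equal to the identity. *)
Lemma opnorm_le_cb_norm : (opnorm (phi (fun=> 1%R)) <= cb_norm phi)%E.
Proof.
apply: ge_ereal_sup => _ [h /= h1 <-].
pose X (l : 'I_k) : 'M[A]_1 := 1%:M; pose x (i : 'I_1) := h.
have X1 l : (mxnorm (X l) <= 1)%E.
  by apply: ge_ereal_sup => _ [v /= v1 <-]; rewrite mul1mx lee_fin.
have amp : amplification phi X ord0 ord0 = phi (fun=> 1).
  rewrite mxE (big_pred1 [ffun=> ord0]) => [|r /=].
    by congr phi; apply/funext => l; rewrite mxE !ffunE eqxx mulr1n.
  by rewrite !ord1 !eqxx; apply/esym/eqP/ffunP => i; rewrite !ord1.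
have tup (y : 'I_1 -> H) : tupnorm y = rnorm (y ord0).
  by rewrite /tupnorm big_ord1 sqrtr_sqr ger0_norm // rnorm_ge0.
apply: (@le_trans _ _ (amplification_norm 1 phi)); last first.
  by apply: ereal_sup_ubound; exists 1%N.
apply: (@le_trans _ _ (opmx_norm (amplification phi X))); last first.
  by apply: ereal_sup_ubound; exists X.
apply: ereal_sup_ubound; exists x; first by rewrite /= tup.
by rewrite tup /opmx_app big_ord1 amp.
Qed.
End Main.

Theorem corollary5p1 (R : realType) (A : cstarAlgType R) (H : hilbertType R)
    (k : nat) (hk : (0 < k)%N) (phi : ('I_k -> A) -> bounded_operator H)
    (phi_lin : multilinear phi) (phi_inv : invariant_map phi)
    (phi_cp : completely_positive phi) :
  cb_norm phi = opnorm (phi (fun=> 1%R)).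
Proof.
apply/eqP; rewrite eq_le opnorm_le_cb_norm andbT.
have [nu [nu0 -> phinu]] := opnorm_bound (phi (fun=> 1)).
apply: ge_ereal_sup => _ [t /= t0 <-].
apply: ge_ereal_sup => _ [X /= X1 <-].
apply: ge_ereal_sup => _ [x /= x1 <-].
by rewrite lee_fin; apply: tupnorm_amplification_le.
Qed.
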